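(* Let $(M,d)$ be a compact metric space and let $\mu$ be a Borel probability measure on $M$ for which there exist constants $0<k<1$ and $c>0$ such that $$\mu(B(x,r))\ge c\,e^{-r^{-k}}$$ for all $x\in M$ and all sufficiently small $r>0$ (that is, for all $x \in M$ and all $0<r\le r_0$, for some $r_0>0$ independent of $x$). Let $u:[0,\infty)\to\mathbb{R}$ be a function for which there exist positive constants $C$ and $L$ such that $0\le u(t)\le C$ for all $t\ge 0$ and $|u(t_1)-u(t_2)|\le L|t_1-t_2|$ for all $t_1,t_2\ge 0$. Then the following hold. (A) For every $b>0$ there exists a function $g$ that minimizes the free energy $\mathcal{E}=\mathcal{E}_b$ with parameter $b$: $$\mathcal{E}[g]=\min_{f>0,\ \int_M f\,d\mu=1}\mathcal{E}[f].$$ The function $g$ solves the Onsager equation $$g(x)=(Z(b))^{-1}e^{-bU(x)},\qquad Z(b)=\int_M e^{-bU(x)}\,d\mu(x),\qquad U(x)=\int_M u(d(x,y))\,g(y)\,d\mu(y).$$ The function $g$ is normalized, $\int_M g\,d\mu=1$, strictly positive, and Lipschitz continuous. (B) Let $b_n\to\infty$ and let $d\nu_n=g_n\,d\mu$ be a sequence of solutions of the Onsager equations corresponding to the parameters $b_n$. Then, after passing to a subsequence (not relabeled), the measures $\nu_n$ converge weakly to a Borel probability measure $\nu$ on $M$. There exists a non-negative Lipschitz continuous function $U_\infty$ on $M$ such that $\nu$ is concentrated on the set $$\Sigma=\Big\{x\in M : U_\infty(x)=\min_{y\in M}U_\infty(y)\Big\},$$ i.e. $\nu(M\setminus\Sigma)=0$.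 Thus, for any continuous function $\phi$ on $M$ supported in the open set $M\setminus\Sigma$, $$\lim_{n\to\infty}\int_M\phi(x)\,g_n(x)\,d\mu(x)=0.$$
   Context: $B(x,r)$ denotes the ball in $M$ centered at $x$ of radius $r$ in the metric $d$. For a probability density $f$ with respect to $\mu$ (a $\mu$-integrable function $f\ge 0$ with $\int_M f\,d\mu=1$), the associated potential is $$U[f](x)=\int_M u(d(x,y))\,f(y)\,d\mu(y),\qquad x\in M,$$ and, for a parameter $b\geq 0$, the free energy is $$\mathcal{E}[f]=\mathcal{E}_b[f]=\int_M\Big\{\log f(x)+\frac{b}{2}\,U[f](x)\Big\}f(x)\,d\mu(x)\in(-\infty,+\infty],$$ with the convention $0\log 0=0$. The minimum in (A) is taken over measurable $f>0$ with $\int_M f\,d\mu=1$. A solution of the Onsager equation with parameter $b$ is a probability density $g$ with respect to $\mu$ satisfying $g=Z^{-1}e^{-bU[g]}$, where $Z=\int_M e^{-bU[g]}\,d\mu$; the probability measure $d\nu=g\,d\mu$ is also called a solution. Weak convergence $\nu_n\to\nu$ means $\int_M\phi\,d\nu_n\to\int_M\phi\,d\nu$ for every continuous $\phi:M\to\mathbb{R}$. *)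

(* Defs.v *)
From HB Require Import structures.
From mathcomp Require Import all_boot all_order all_algebra.
From mathcomp Require Import all_classical all_reals all_analysis.

Set Implicit Arguments.
Unset Strict Implicit.
Unset Printing Implicit Defensive.

Import Order.TTheory GRing.Theory Num.Theory.
Import numFieldNormedType.Exports.

Local Open Scope classical_set_scope.
Local Open Scope ring_scope.

(* The sigma-algebra is not tied to the metric by this structure; that it is
   the Borel one is a separate hypothesis ([is_borel]).
   Measurable types are pointed, which only adds that M is nonempty, as it must
   be to carry a probability measure. *)
#[short(type="measurableMetricType")]
HB.structure Definition MeasurableMetric (d : measure_display)
    (R : realType) := { M of Measurable d M & Metric R M }.

Definition is_borel (d : measure_display) (R : realType)
    (M : measurableMetricType d R) : Prop :=
  @measurable d M = <<s @open M >>.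

(* [lipschitz] in the library is restricted to normed modules. *)
Definition lipschitz_metric (R : realType) (M : metricType R)
    (f : M -> R) : Prop :=
  exists2 L : R, 0 <= L & forall x y, `|f x - f y| <= L * mdist x y.

Definition argmin (R : realType) (T : Type) (f : T -> R) : set T :=
  [set x | forall y, f x <= f y].

Section onsager.
Context {d : measure_display} {R : realType} {M : measurableMetricType d R}.
Variable mu : probability M R.
Implicit Types (u : R -> R) (f g : M -> R) (b : R).

Definition prob_density f : Prop :=
  [/\ mu.-integrable setT (EFin \o f), forall x, 0 <= f x
    & (\int[mu]_x (f x)%:E = 1)%E].

(* [u] is only ever evaluated on [0, +oo[. *)
Definition potential u f (x : M) : R :=
  \int[mu]_y (u (mdist x y) * f y).

(* Valued in \bar R.  For u >= 0, b >= 0 and f a density, the negative part of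
   the integrand is at most 1/e, so the value is never -oo.  The convention
   0 log 0 = 0 holds since [ln] is total. *)
Definition free_energy u b f : \bar R :=
  (\int[mu]_x ((ln (f x) + b / 2 * potential u f x) * f x)%:E)%E.

Definition pos_normalized f : Prop :=
  [/\ measurable_fun setT f, forall x, 0 < f x
    & (\int[mu]_x (f x)%:E = 1)%E].

Definition minimizes_free_energy u b g : Prop :=
  pos_normalized g /\
  forall f, pos_normalized f -> (free_energy u b g <= free_energy u b f)%E.

Definition partition_fun u b g : R :=
  \int[mu]_x expR (- b * potential u g x).

Definition onsager_solution u b g : Prop :=
  prob_density g /\
  forall x, g x = (partition_fun u b g)^-1 * expR (- b * potential u g x).

Definition has_density (nu : probability M R) g : Prop :=
  forall A, measurable A -> (nu A = \int[mu]_(x in A) (g x)%:E)%E.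

End onsager.

Definition weak_cvg (d : measure_display) (R : realType)
    (M : measurableMetricType d R)
    (nu_ : nat -> probability M R) (nu : probability M R) : Prop :=
  forall phi : M -> R, continuous phi ->
    \int[nu_ n]_x phi x @[n --> \oo] --> \int[nu]_x phi x.

(* Main.v *)
(** For (A), let [f_n] be a minimizing sequence and [g_n] the Gibbs density
    [exp (- b U[f_n]) / Z_n].  Moving [f_n] slightly towards [g_n] changes the
    energy at first order by minus the relative entropy of [f_n] with respect to
    [g_n], so this relative entropy tends to 0 and [f_n - g_n] tends to 0 in L1.
    Along a subsequence the potentials [U[f_n]] converge pointwise to some [V];
    then [g_n] converges to the Gibbs density [g] of [V], which forces
    [V = U[g]], and the energy of [g] is the infimum.

    For (B), masses of the cells of countably many finite partitions converge
    along a diagonal subsequence, hence so do the integrals of all continuous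
    functions; the limit functional is represented by a measure [nu] by a
    Daniell-type construction.  The potentials converge uniformly to the
    potential [Uoo] of [nu].  Since a density has nonnegative entropy,
    [b_n \int U_n d(nu_n) <= - ln Z_n], and [Z_n] is bounded below by its
    contribution from a small ball around a minimum point of [Uoo]; dividing by
    [b_n] gives [\int Uoo d(nu) <= min Uoo]. *)

Require Import Defs.
From HB Require Import structures.
From mathcomp Require Import all_boot all_order all_algebra.
From mathcomp Require Import all_classical all_reals all_analysis.
From mathcomp Require Import measurable_realfun esum.
From mathcomp Require Import ring lra.

Set Implicit Arguments.
Unset Strict Implicit.
Unset Printing Implicit Defensive.

Import Order.TTheory GRing.Theory Num.Theory.
Import numFieldNormedType.Exports.

Local Open Scope classical_set_scope.
Local Open Scope ring_scope.

(** * Extraction of subsequences and normalization of measures *)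

(** The rows of [a] lie in a product of unit intervals, compact by Tychonoff, so they cluster at
    some [l]. A neighbourhood of [l] controls finitely many coordinates at once; step [n] picks a
    row close to [l] in the first [n] coordinates. *)
Lemma diagonal_extraction (R : realType) (a : nat -> nat -> R) :
  (forall n k, 0 <= a n k <= 1) ->
  exists2 s : nat -> nat, {homo s : m n / (m < n)%N} &
    exists l : nat -> R, forall k, a (s n) k @[n --> \oo] --> l k.
Proof.
move=> a01.
pose X := prod_topology (fun _ : nat => R).
have cK : compact [set f : X | forall k, `[0, 1]%classic (f k)].
  exact: (@tychonoff _ (fun _ : nat => R) (fun _ => `[0, 1]%classic)
    (fun _ => @segment_compact R 0 1)).
have [|l [_ al]] := cK (fmap (fun n => a n : X) \oo).
  by exists 0%N => // n _ k; rewrite /= in_itv/=.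
have near_l k (e : R) : 0 < e ->
    nbhs (l : X) [set f : X | forall j, (j < k)%N -> `|f j - l j| < e].
  move=> e0; elim: k => [|k ih].
    by apply: filterS filterT => f _ j; rewrite ltn0.
  have lk : nbhs (l : X) [set f : X | ball (l k) e (f k)].
    exact: (@proj_continuous nat (fun _ => R) k l _ (nbhsx_ballx (l k) e e0)).
  move: ih lk; apply: filterS2 => f fj fk j; rewrite ltnS leq_eqVlt.
  by move=> /predU1P[->|]; [rewrite distrC|exact: fj].
have next N k : exists n, (N < n)%N /\
    forall j, (j < k)%N -> `|a n j - l j| < k.+1%:R^-1.
  have [|f [[n Nn <-] fl]] := al ((fun n => a n : X) @` [set n | (N < n)%N]) _ _
    (near_l k k.+1%:R^-1 ltac:(by [])).
    by exists N.+1 => // n Nn; exists n.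
  by exists n.
have [g gP] := choice (fun Nk : nat * nat => next Nk.1 Nk.2).
(* Nothing is asked of row [s 0], so its value is arbitrary. *)
pose s := fix s n := if n is m.+1 then g (s m, n) else g (0, 0)%N.
have s_lt n : (s n < s n.+1)%N by have [] := gP (s n, n.+1).
have s_l n j : (j < n)%N -> `|a (s n) j - l j| < n.+1%:R^-1.
  by case: n => // n; have [_] := gP (s n, n.+1); exact.
exists s; first exact: (homo_ltn ltn_trans s_lt).
exists l => k; apply/cvgrPdist_lt => e e0.
near=> n; rewrite distrC; apply: (@lt_trans _ _ n.+1%:R^-1).
  by apply: s_l; near: n; exists k.+1.
by near: n; exact: near_infty_natSinv_lt (PosNum e0).
Unshelve. all: by end_near. Qed.

(** The Dirac mass is only the fallback of [mnormalize] for total mass zero or infinite, excluded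
    here. *)
Lemma probability_of_measure d (T : measurableType d) (R : realType)
    (m : {measure set T -> \bar R}) : m setT = 1%E ->
  exists P : probability T R, forall A, P A = m A.
Proof.
move=> m1; exists (mnormalize m (dirac point : probability T R)) => A.
rewrite -[LHS]/(mnormalize m (dirac point : probability T R) A) /mnormalize.
case: ifPn => [/orP[]/eqP h|_].
- by have /eqP := etrans (esym m1) h; rewrite onee_eq0.
- by have := etrans (esym m1) h.
- by rewrite (_ : fine _ = 1) ?invr1 ?mule1//; exact: (congr1 fine m1).
Qed.

(** * Entropy inequalities *)

Section entropy_inequalities.
Variable R : realType.
Implicit Types x y z a t lam : R.

(** The convex function [x ln x] lies above its tangent line at [z]; this is [ln s <= s - 1] at
    [s = z / x], multiplied by [x]. *)
Lemma xlnx_tangent x z : 0 < x -> 0 < z -> x - z <= x * ln x - x * ln z.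
Proof.
move=> x0 z0; have zx : 0 < z / x by rewrite divr_gt0.
have : ln (z / x) <= z / x - 1.
  by have := @le_ln1Dx R (z / x - 1); rewrite addrCA subrr addr0; apply; lra.
rewrite ln_div ?posrE// -(ler_pM2l x0) !mulrBr mulr1.
by rewrite [x * (z / x)]mulrCA divff ?gt_eqF// mulr1; lra.
Qed.

Lemma xlnx_ge x : 0 < x -> x - 1 <= x * ln x.
Proof. by move=> x0; have := xlnx_tangent x0 ltr01; rewrite ln1 mulr0 subr0. Qed.

(** The tangent at the mixture [z] bounds both endpoint values from below; in the weighted sum the
    terms [x - z] and [y - z] cancel. *)
Lemma xlnx_convex x y t : 0 < x -> 0 < y -> 0 <= t <= 1 ->
  ((1 - t) * x + t * y) * ln ((1 - t) * x + t * y) <=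
  (1 - t) * (x * ln x) + t * (y * ln y).
Proof.
move=> x0 y0 /andP[t0 t1]; set z := (1 - t) * x + t * y.
have z0 : 0 < z.
  rewrite /z; have [->|tn1] := eqVneq t 1; first by lra.
  have t1' : t < 1 by rewrite lt_neqAle tn1.
  by apply: ltr_pwDl; [rewrite mulr_gt0//; lra|rewrite mulr_ge0// ltW].
have := ler_wpM2l t0 (xlnx_tangent y0 z0).
have t1' : 0 <= 1 - t by lra.
have := ler_wpM2l t1' (xlnx_tangent x0 z0).
have : (1 - t) * (x - z) + t * (y - z) = 0 by rewrite /z; ring.
have -> : z * ln z = (1 - t) * (x * ln z) + t * (y * ln z) by rewrite {1}/z; ring.
rewrite !(mulrBr (1 - t)) !(mulrBr t); lra.
Qed.

(** [expR a <= 1 / (1 - a)], and [(1 + a + 2 a^2) (1 - a) = 1 + a^2 (1 - 2 a)] is at least 1. *)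
Lemma expR_le_quadratic a : `|a| <= 1 / 2 -> expR a <= 1 + a + 2 * a ^+ 2.
Proof.
rewrite ler_norml => /andP[a1 a2].
have e0 := expR_gt0 (- a).
have h : 1 - a <= expR (- a) by exact: expR_ge1Dx.
rewrite -[a in expR a]opprK expRN -div1r ler_pdivrMr//.
have p : 0 <= 1 + a + 2 * a ^+ 2 by have := sqr_ge0 a; lra.
apply: le_trans (ler_wpM2l p h).
have : 0 <= a ^+ 2 * (1 - 2 * a) by rewrite mulr_ge0 ?sqr_ge0//; lra.
rewrite !expr2; lra.
Qed.

(* Young's inequality for the conjugate pair [x ln x - x] and [exp]; integrated,
   it bounds the L1 distance by relative entropy (a weak form of Pinsker). *)
Lemma dist_le_entropy x y lam : 0 < x -> 0 < y -> 0 < lam -> lam <= 1 / 2 ->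
  `|x - y| <= (x * ln x - x * ln y - x + y) / lam + 2 * lam * y.
Proof.
move=> x0 y0 l0 l1.
(* Tangent inequality at [y * expR a], with [expR a] replaced by its quadratic bound; [a = lam] and
   [a = - lam] give the two sides of the absolute value. *)
have main a : `|a| <= 1 / 2 ->
    a * (x - y) <= x * ln x - x * ln y - x + y + 2 * a ^+ 2 * y.
  move=> a1; have ya : 0 < y * expR a by rewrite mulr_gt0// expR_gt0.
  have := xlnx_tangent x0 ya.
  rewrite lnM ?posrE ?expR_gt0// expRK.
  have := ler_wpM2l (ltW y0) (expR_le_quadratic a1).
  lra.
rewrite ler_norml -(ler_pM2l l0) -[X in _ && X](ler_pM2l l0).
rewrite mulrN !mulrDr mulrCA divff ?gt_eqF// mulr1.
have := main lam; have := main (- lam).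
rewrite normrN gtr0_norm// sqrrN !expr2 => /(_ l1) + /(_ l1).
lra.
Qed.

Lemma expR_dist x y : 0 <= x -> 0 <= y -> `|expR (- x) - expR (- y)| <= `|x - y|.
Proof.
wlog xy : x y / x <= y => [H x0 y0|x0 y0].
  have [/H->//|/ltW /H h] := leP x y.
  by rewrite distrC (distrC x); exact: h.
rewrite ger0_norm ?subr_ge0 ?ler_expR ?lerN2//.
rewrite distrC ger0_norm ?subr_ge0//.
have e1 : expR (- x) <= 1 by rewrite -expR0 ler_expR oppr_le0.
have -> : expR (- y) = expR (- x) * expR (x - y).
  by rewrite -expRD; congr expR; ring.
have h : 1 + (x - y) <= expR (x - y) by exact: expR_ge1Dx.
have e0 := expR_ge0 (- x).
have h1 : expR (x - y) <= 1 by rewrite -expR0 ler_expR; lra.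
rewrite -{1}[expR (- x)]mulr1 -mulrBr.
apply: (@le_trans _ _ (1 * (1 - expR (x - y)))); last by lra.
by rewrite ler_wpM2r//; lra.
Qed.

End entropy_inequalities.

(** * Compact metric spaces with a Borel probability measure *)

Section metric_measure.
Context {d : measure_display} {R : realType} {M : measurableMetricType d R}.
Hypotheses (hb : is_borel M) (hc : compact [set: M]).

Lemma near_mdist (x : M) (e : R) : 0 < e -> \forall y \near x, mdist x y < e.
Proof. by move=> e0; have := nbhsx_ballx x e e0; rewrite ballEmdist. Qed.

Lemma continuous_measurable (f : M -> R) : continuous f -> measurable_fun setT f.
Proof.
move=> /continuousP cf.
apply: (measurability _ (RGenOpens.measurableE R)).
move=> _ [_ [a [b ->] <-]]; rewrite setTI hb; apply: sub_sigma_algebra.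
exact/cf/interval_open.
Qed.

Lemma lipschitz_metric_continuous (f : M -> R) :
  lipschitz_metric f -> continuous f.
Proof.
move=> [L L0 fL] x; apply/cvgrPdist_lt => e e0.
have L1 : 0 < L + 1 by rewrite ltr_wpDl.
near=> y.
apply: le_lt_trans (fL x y) _.
have : mdist x y < e / (L + 1) by near: y; apply: near_mdist; rewrite divr_gt0.
rewrite ltr_pdivlMr// mulrC; apply: le_lt_trans.
by rewrite ler_wpM2r ?mdist_ge0// lerDl.
Unshelve. all: by end_near. Qed.

Lemma mdist_dist (x y z : M) : `|mdist x y - mdist x z| <= mdist y z.
Proof.
rewrite ler_norml.
have := metric_triangle x y z.
have := metric_triangle x z y; rewrite (metric_sym z y).
lra.
Qed.

Lemma continuous_mdist (x : M) : continuous (mdist x).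
Proof.
apply: lipschitz_metric_continuous; exists 1 => // y z.
by rewrite mul1r; exact: mdist_dist.
Qed.

Lemma measurable_mball (x : M) (e : R) : measurable (ball x e : set M).
Proof.
rewrite ballEmdist (_ : mkset _ = setT `&` mdist x @^-1` `]-oo, e[).
  by apply: continuous_measurable => //; exact: continuous_mdist.
by apply/seteqP; split => y /=; rewrite in_itv/= => //; case.
Qed.

Lemma finite_net (e : R) : 0 < e ->
  exists s : seq M, forall y, exists2 x, x \in s & mdist x y < e.
Proof.
move=> e0.
have := hc; rewrite compact_cover.
move=> /(_ M setT (fun x => [set y | mdist x y < e])) [].
- move=> x _; rewrite (_ : mkset _ = mdist x @^-1` [set r | r < e])//.
  by apply: open_comp => [y _|]; [exact: continuous_mdist|exact: open_lt].
- by move=> x _; exists x => //=; rewrite mdistxx.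
- move=> D _ DM; exists (finmap.enum_fset D) => y.
  by have [x /= xD xy] := DM y I; exists x.
Qed.

(** [j y] is the index of the first point of a finite net within [e] of [y]; each cell is thus a
    ball minus the earlier balls, hence measurable. *)
Lemma quantizer (e : R) : 0 < e ->
  exists (N : nat) (x : nat -> M) (j : M -> nat),
    [/\ forall y, (j y < N)%N, forall y, mdist (x (j y)) y < e &
        forall i, measurable [set y | j y = i]].
Proof.
move=> e0; have [s sM] := finite_net e0.
pose j y := find (fun x => mdist x y < e) s.
have hs y : has (fun x => mdist x y < e) s.
  by have [x xs xy] := sM y; apply/hasP; exists x.
exists (size s), (nth point s), j; split => [y|y|].
- by rewrite /j -has_find.
- by have := nth_find point (hs y).
- rewrite /j; elim: s {sM j hs} => [|x s ih] [|i] /=.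
  + by rewrite (_ : mkset _ = setT)//; apply/seteqP; split.
  + by rewrite (_ : mkset _ = set0)//; apply/seteqP; split.
  + rewrite (_ : mkset _ = mdist x @^-1` [set r | r < e]).
      rewrite -[_ @^-1` _]setTI; apply: continuous_measurable => //.
        exact: continuous_mdist.
      by rewrite -set_itvNyo.
    by apply/seteqP; split => y /=; case: ifPn.
  + rewrite (_ : mkset _ = ~` (mdist x @^-1` [set r | r < e]) `&`
      [set y | find (fun x => mdist x y < e) s = i]).
      apply: measurableI => //; apply: measurableC.
      rewrite -[_ @^-1` _]setTI; apply: continuous_measurable => //.
        exact: continuous_mdist.
      by rewrite -set_itvNyo.
    apply/seteqP; split => y /=; first by case: ifPn => // /negP ? [].
    by move=> [/negP/negbTE -> ->].
Qed.

(** * Integration against a probability density *)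

Section density.
Variable mu : probability M R.
Implicit Types (f phi psi : M -> R) (c w : R).

Lemma Rintegral_sum N (F : 'I_N -> M -> R) :
  (forall i, mu.-integrable setT (EFin \o F i)) ->
  \int[mu]_x (\sum_(i < N) F i x) = \sum_(i < N) \int[mu]_x F i x.
Proof.
move=> iF; rewrite /Rintegral.
under eq_integral do rewrite -sumEFin.
rewrite integral_sum// -[RHS]/(\sum_(i < N) fine _)%R sum_fine// => i _.
exact: integrable_fin_num (iF i).
Qed.

Lemma integrable_bddM f phi c :
  mu.-integrable setT (EFin \o f) -> measurable_fun setT phi ->
  (forall x, `|phi x| <= c) ->
  mu.-integrable setT (EFin \o (fun x => phi x * f x)).
Proof.
move=> fi mphi phic.
apply: (@eq_integrable _ _ _ mu _ measurableT
  ((EFin \o phi) \* (EFin \o f))%E _ (fun _ _ => erefl)).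
apply: integrableMr => //; exists c; split; first exact: num_real.
by move=> x cx y _; apply: le_trans (phic y) (ltW cx).
Qed.

Lemma integrable_bdd phi c : measurable_fun setT phi ->
  (forall x, `|phi x| <= c) -> mu.-integrable setT (EFin \o phi).
Proof.
move=> mphi phic; apply: measurable_bounded_integrable => //.
  by rewrite -ge0_fin_numE ?fin_num_measure.
exists c; split; first exact: num_real.
by move=> x cx y _; apply: le_trans (phic y) (ltW cx).
Qed.

Lemma integrable_cst (c : R) : mu.-integrable setT (EFin \o (fun=> c)).
Proof. exact: finite_measure_integrable_cst. Qed.

Lemma Rintegral_prob_cst (c : R) : \int[mu]_x c = c.
Proof.
rewrite Rintegral_cst// -[RHS]mulr1; congr (_ * _).
exact: (congr1 fine (probability_setT mu)).
Qed.

Lemma Rintegral_density f : prob_density mu f -> \int[mu]_x f x = 1.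
Proof. by case=> _ _ f1; rewrite /Rintegral f1. Qed.

Lemma density_le f phi psi c c' : prob_density mu f ->
  measurable_fun setT phi -> (forall x, `|phi x| <= c) ->
  measurable_fun setT psi -> (forall x, `|psi x| <= c') ->
  (forall x, phi x <= psi x) ->
  \int[mu]_x (phi x * f x) <= \int[mu]_x (psi x * f x).
Proof.
move=> [fi f0 _] mphi phic mpsi psic le; apply: le_Rintegral => //.
- exact: integrable_bddM.
- exact: integrable_bddM.
- by move=> x _; rewrite ler_wpM2r.
Qed.

Lemma density_cst f c : prob_density mu f -> \int[mu]_x (c * f x) = c.
Proof.
move=> fd; rewrite RintegralZl//; last by case: fd.
by rewrite Rintegral_density ?mulr1.
Qed.

Lemma density_bound f phi c : prob_density mu f ->
  measurable_fun setT phi -> (forall x, `|phi x| <= c) ->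
  `|\int[mu]_x (phi x * f x)| <= c.
Proof.
move=> fd mphi phic.
have c0 : 0 <= c by apply: le_trans (phic point).
rewrite ler_norml -{1}(density_cst (- c) fd) -{2}(density_cst c fd).
apply/andP; split; apply: density_le => //; try exact: phic.
- by move=> x; have := phic x; rewrite ler_norml => /andP[].
- by move=> x; have := phic x; rewrite ler_norml => /andP[].
Qed.

(** The sum is the integral against [f] of the step function [phi (x (j y))], which is within [w] of
    [phi]. Up to [w], integrals are thus governed by finitely many cell masses. *)
Lemma quantized_integral f phi c w N (x : nat -> M) (j : M -> nat) :
  prob_density mu f ->
  measurable_fun setT phi -> (forall y, `|phi y| <= c) ->
  (forall y, (j y < N)%N) -> (forall i, measurable [set y | j y = i]) ->
  (forall y, `|phi y - phi (x (j y))| <= w) ->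
  `|\int[mu]_y (phi y * f y) -
    \sum_(i < N) phi (x i) * \int[mu]_y (\1_[set y | j y = i] y * f y)| <= w.
Proof.
move=> fd mphi phic jN mj phiw.
have fi : mu.-integrable setT (EFin \o f) by case: fd.
have mind (i : nat) : measurable_fun setT (\1_[set y | j y = i] : M -> R).
  exact: measurable_indic.
have ind1 (i : nat) y : `|\1_[set y | j y = i] y : R| <= 1.
  by rewrite indicE; case: (_ \in _); rewrite ?normr1 ?normr0.
have E y : phi (x (j y)) = \sum_(i < N) phi (x i) * \1_[set y | j y = i] y.
  rewrite (bigD1 (Ordinal (jN y)))//= indicE mem_set// mulr1 big1 ?addr0//.
  move=> i ij; rewrite indicE memNset ?mulr0//= => jyi.
  by move/eqP: ij; apply; apply: val_inj => /=; rewrite jyi.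
have mq : measurable_fun setT (fun y => phi (x (j y))).
  under eq_fun do rewrite E; apply: measurable_sum => i.
  by apply: measurable_funM.
have bq y : `|phi (x (j y))| <= c by exact: phic.
have -> : \sum_(i < N) phi (x i) * \int[mu]_y (\1_[set y | j y = i] y * f y) =
   \int[mu]_y (phi (x (j y)) * f y).
  under [RHS]eq_Rintegral do rewrite E mulr_suml.
  under [RHS]eq_Rintegral do under eq_bigr do rewrite -mulrA.
  rewrite Rintegral_sum//; last first.
    by move=> i; apply: integrable_bddM => //; exact: integrable_bddM (mind i) (ind1 i).
  apply: eq_bigr => i _; rewrite RintegralZl//.
  exact: integrable_bddM.
rewrite -RintegralB//; [|exact: integrable_bddM..].
under eq_Rintegral do rewrite -mulrBl.
apply: density_bound => //; exact: measurable_funB.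
Qed.

(** Compactness in near-covering form, for the filter of small positive radii, turns radii that work
    near each point into one that works everywhere. *)
Lemma compact_uniformly_continuous phi (e : R) : continuous phi -> 0 < e ->
  exists2 r : R, 0 < r & forall x y, mdist x y < r -> `|phi x - phi y| < e.
Proof.
move=> cphi e0.
have e2 : 0 < e / 2 by rewrite divr_gt0.
have := hc; rewrite compact_near_coveringP.
move=> /(_ R (0 : R)^'+
  (fun r z => forall y, mdist z y < r -> `|phi z - phi y| < e) _) [].
  move=> x _.
  have /cvgrPdist_lt/(_ _ e2)/nbhs_ballP[r /= r0 rx] := cphi x.
  have r2 : 0 < r / 2 by rewrite divr_gt0.
  exists ([set z | mdist x z < r / 2], [set t | 0 < t < r / 2]).
    split => /=; first exact: near_mdist.
    near=> t; apply/andP; split; near: t; first exact: nbhs_right_gt.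
    exact: nbhs_right_lt.
  move=> [z t] [/= xz /andP[t0 tr]] y zy.
  have rz : `|phi x - phi z| < e / 2.
    by apply: rx; rewrite ballEmdist/=; lra.
  have ry : `|phi x - phi y| < e / 2.
    by apply: rx; rewrite ballEmdist/=; have := metric_triangle x z y; lra.
  rewrite (splitr e) -(subrKA (phi x)); apply: le_lt_trans (ler_normD _ _) _.
  by rewrite ltrD// distrC.
move=> r /= r0 rP.
have r2 : 0 < r / 2 by rewrite divr_gt0.
exists (r / 2) => // x y xy; apply: (rP (r / 2)) => //=.
by rewrite sub0r normrN gtr0_norm//; lra.
Unshelve. all: by end_near. Qed.

Lemma compact_bounded phi : continuous phi -> exists c, forall x, `|phi x| <= c.
Proof.
move=> cphi.
have cn : continuous (fun x => `|phi x|).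
  by move=> x; apply: continuous_comp; [exact: cphi|exact: norm_continuous].
have [| |x _ xP] := @compact_EVT_max M R (fun x => `|phi x|) setT _ hc.
- by exists point.
- exact: continuous_subspaceT.
- by exists `|phi x| => y; by rewrite xP ?inE.
Qed.

(** Integrals of continuous functions are approximated by combinations of cell masses, so it
    suffices that the countably many masses, for cells of radius [1 / (m + 1)], all converge. *)
Lemma density_extraction (f_ : nat -> M -> R) :
  (forall n, prob_density mu (f_ n)) ->
  exists2 s : nat -> nat, {homo s : m n / (m < n)%N} &
    forall phi, continuous phi ->
      cvgn (fun n => \int[mu]_x (phi x * f_ (s n) x)).
Proof.
move=> fd.
have Q m : 0 < m.+1%:R^-1 :> R by [].
have [N] := choice (fun m => quantizer (Q m)).
move=> /choice[x] /choice[j] /all_and3[jN xj mj].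
(* All masses go into one array indexed by codes of pairs (partition, cell); the other codes get
   [0], which stays in the unit interval. *)
pose a n k := if unpickle k is Some (m, i) then
  \int[mu]_y (\1_[set y | j m y = i] y * f_ n y) else 0.
have [|s s_lt [l al]] := @diagonal_extraction R a.
  move=> n k; rewrite /a; case: unpickle => [[m i]|]; last by rewrite lexx ler01.
  apply/andP; split.
    apply: Rintegral_ge0 => y _; apply: mulr_ge0; last by case: (fd n).
    by rewrite indicE ler0n.
  rewrite -[leRHS](Rintegral_density (fd n)).
  apply: le_trans (ler_norm _) _; rewrite (Rintegral_density (fd n)).
  apply: (density_bound (phi := \1_[set y | j m y = i]) (fd n)).
    exact: measurable_indic.
  by move=> y; rewrite indicE; case: (_ \in _); rewrite ?normr1 ?normr0.
exists s => // phi cphi.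
have mphi := continuous_measurable cphi.
have [c phic] := compact_bounded cphi.
apply: cauchy_cvg; apply: cauchy_exP => e e0.
have e2 : 0 < e / 2 by rewrite divr_gt0.
have [r r0 phir] := compact_uniformly_continuous cphi e2.
have [m mr] : exists m, m.+1%:R^-1 < r.
  have [m _ mP] := near_infty_natSinv_lt (PosNum r0).
  by exists m; exact: (mP m (leqnn m)).
pose S n := \sum_(i < N m) phi (x m i) *
  \int[mu]_y (\1_[set y | j m y = i] y * f_ (s n) y).
pose S0 := \sum_(i < N m) phi (x m i) * l (pickle (m, (i : nat))).
have SS0 : S n @[n --> \oo] --> S0.
  apply: cvg_big => [|i _]; first exact: add_continuous.
  apply: cvgM; first exact: cvg_cst.
  by have := al (pickle (m, (i : nat))); rewrite /a pickleK.
(* [cauchy_exP] accepts a centre depending on [e]; half of [e] goes to quantization, half to the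
   convergence of the masses. *)
exists S0; move/cvgrPdist_lt : SS0 => /(_ _ e2).
apply: filterS => n Sn; rewrite /ball/= -(subrKA (S n)) (splitr e).
apply: le_lt_trans (ler_normD _ _) _; rewrite ltr_leD// distrC.
apply: quantized_integral phic (jN m) (mj m) _ => // y.
by apply/ltW/phir; rewrite metric_sym; apply: lt_trans (xj m y) mr.
Qed.

End density.

(** * Separation of open sets and rearrangement of double series *)

(** [psi k] is the minimum of [1] and [k D], with [D] the distance to the complement of [G]
    truncated at [1]; the truncation also covers the case where [G] is all of [M]. As [G] is open,
    [D] is positive on [G], so [psi k x] reaches [1] there. *)
Lemma open_separator (G : set M) : open G ->
  exists psi : nat -> M -> R,
    [/\ forall k, continuous (psi k), forall x, psi 0%N x = 0,
        forall k x, psi k x <= psi k.+1 x <= 1,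
        forall k x, ~ G x -> psi k x = 0 &
        forall x, G x -> exists k, psi k x = 1].
Proof.
move=> oG.
pose S x := 1 |` [set mdist x y | y in ~` G].
have S0 x : lbound (S x) 0.
  by move=> _ [->|[y _ <-]]; [exact: ler01|exact: mdist_ge0].
have Slb x : has_lbound (S x) by exists 0; exact: S0.
have Sn x : S x !=set0 by exists 1; left.
pose D x := inf (S x).
have D0 x : 0 <= D x by apply: lb_le_inf.
have DL x z : D x <= D z + mdist x z.
  rewrite -lerBlDr; apply: lb_le_inf => //.
  move=> _ [->|[y Gy <-]].
    rewrite lerBlDr; apply: (@le_trans _ _ 1); last by rewrite lerDl mdist_ge0.
    by apply: ge_inf => //; left.
  rewrite lerBlDr; apply: (@le_trans _ _ (mdist x y)).
    by apply: ge_inf => //; right; exists y.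
  by rewrite addrC metric_triangle.
have cD : continuous D.
  apply: lipschitz_metric_continuous; exists 1 => // x z; rewrite mul1r ler_norml.
  by have := DL x z; have := DL z x; rewrite (metric_sym z x); lra.
exists (fun k x => Num.min 1 (k%:R * D x)); split.
- move=> k x; apply: (@continuous_min _ _ (fun=> 1) (fun x => k%:R * D x)).
    exact: cst_continuous.
  by apply: continuousM; [exact: cst_continuous|exact: cD].
- by move=> x; rewrite mul0r; apply/min_idPr.
- move=> k x; rewrite le_min !ge_min !lexx/= andbT; apply/orP; right.
  by rewrite ler_wpM2r// ler_nat.
- move=> k x Gx; rewrite (_ : D x = 0) ?mulr0; first exact/min_idPr.
  apply/eqP; rewrite eq_le D0 andbT -(mdistxx x).
  by apply: ge_inf => //; right; exists x.
- move=> x Gx.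
  have /nbhs_ballP[r /= r0 rG] : nbhs x G by exact: open_nbhs_nbhs.
  have Dp : 0 < D x.
    apply: (@lt_le_trans _ _ (Num.min 1 r)); first by rewrite lt_min ltr01.
    apply: lb_le_inf => // _ [->|[y Gy <-]]; first by rewrite ge_min lexx.
    rewrite ge_min; apply/orP; right; rewrite leNgt; apply/negP => xy.
    by apply: Gy; apply: rG; rewrite ballEmdist.
  exists (Num.truncn (D x)^-1).+1; apply/min_idPl.
  rewrite -ler_pdivrMr// div1r ltW//.
  by have := truncnS_gt (D x)^-1.
Qed.

(** The enumeration of pairs is chosen before [F]: the same one must rearrange a family of functions
    at every point and the family of its costs. *)
Lemma nneseries_pair : exists h : nat -> nat * nat,
  forall F : nat -> nat -> \bar R, (forall i j, (0 <= F i j)%E) ->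
  (\sum_(n <oo) F (h n).1 (h n).2 = \sum_(i <oo) \sum_(j <oo) F i j)%E.
Proof.
have /ppcard_eqP[h] : ([set: nat] #= [set: nat * nat])%card.
  by rewrite card_eq_sym; exact: card_nat2.
exists h => F F0; rewrite nneseries_esumT//.
rewrite -(reindex_esum [set: nat] [set: nat * nat] h (fun k => F k.1 k.2))//.
rewrite (_ : setT = setT `*`` (fun=> setT)); last by apply/seteqP; split.
rewrite -(@esum_esum _ _ _ _ _ F)// nneseries_esumT; last first.
  by move=> i; apply: nneseries_ge0.
by apply: eq_esum => i _; rewrite nneseries_esumT.
Qed.

(** * Riesz representation *)

Section riesz.
Variable Lam : (M -> R) -> R.
Implicit Types (phi psi : M -> R) (c : R).
Hypothesis LamD : forall phi psi, continuous phi -> continuous psi ->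
  Lam (phi \+ psi) = Lam phi + Lam psi.
Hypothesis LamZ : forall c phi, continuous phi ->
  Lam (fun x => c * phi x) = c * Lam phi.
Hypothesis Lam_ge0 : forall phi, continuous phi -> (forall x, 0 <= phi x) ->
  0 <= Lam phi.
Hypothesis Lam1 : Lam (fun=> 1) = 1.

Let ccst (c : R) : continuous (fun _ : M => c).
Proof. exact: cst_continuous. Qed.

Let cmul phi psi : continuous phi -> continuous psi ->
  continuous (fun x => phi x * psi x).
Proof. by move=> cphi cpsi x; apply: cvgM; [exact: cphi|exact: cpsi]. Qed.

Let csub phi psi : continuous phi -> continuous psi ->
  continuous (fun x => phi x - psi x).
Proof. by move=> cphi cpsi x; apply: cvgB; [exact: cphi|exact: cpsi]. Qed.

Let Lam0 : Lam (fun=> 0) = 0.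
Proof.
rewrite (_ : (fun=> 0) = (fun x => 0 * (fun=> 1) x) :> (M -> R)); last first.
  by apply/funext => x; rewrite mul0r.
by rewrite LamZ ?mul0r//; exact: ccst.
Qed.

Let LamB phi psi : continuous phi -> continuous psi ->
  Lam (fun x => phi x - psi x) = Lam phi - Lam psi.
Proof.
move=> cphi cpsi; rewrite (_ : (fun x => _) = phi \+ (fun x => -1 * psi x)).
  by rewrite LamD ?LamZ ?mulN1r//; exact: cmul.
by apply/funext => x /=; rewrite mulN1r.
Qed.

Let Lam_le phi psi : continuous phi -> continuous psi ->
  (forall x, phi x <= psi x) -> Lam phi <= Lam psi.
Proof.
move=> cphi cpsi le; rewrite -subr_ge0 -LamB//; apply: Lam_ge0 => [|x].
  exact: csub.
by rewrite subr_ge0.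
Qed.

Let Lam_sum (n : nat) (P : nat -> M -> R) : (forall i, continuous (P i)) ->
  Lam (fun x => \sum_(i < n) P i x) = \sum_(i < n) Lam (P i) /\
  continuous (fun x => \sum_(i < n) P i x).
Proof.
move=> cP; elim: n => [|n [ih cn]].
  rewrite big_ord0 -Lam0; split; last first.
    by under eq_fun do rewrite big_ord0; exact: ccst.
  by congr Lam; apply/funext => x; rewrite big_ord0.
rewrite big_ord_recr/= -ih -LamD//.
rewrite (_ : (fun x => \sum_(i < n.+1) P i x) =
  (fun x => \sum_(i < n) P i x) \+ P n).
  by split => // x; apply: cvgD; [exact: cn|exact: cP].
by apply/funext => x; rewrite big_ord_recr.
Qed.

(* Covering by sums of continuous functions makes countable subadditivity of
   the resulting outer measure immediate. *)
Definition fun_cover (A : set M) (P : nat -> M -> R) :=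
  [/\ forall i, continuous (P i), forall i x, 0 <= P i x &
      forall x, A x -> (1 <= \sum_(i <oo) (P i x)%:E)%E].

Definition daniell (A : set M) : \bar R :=
  ereal_inf [set (\sum_(i <oo) (Lam (P i))%:E)%E | P in fun_cover A].

Let cost_ge0 A P i : fun_cover A P -> (0 <= (Lam (P i))%:E)%E.
Proof. by move=> [cP P0 _]; rewrite lee_fin Lam_ge0. Qed.

Let daniell_le A P : fun_cover A P ->
  (daniell A <= \sum_(i <oo) (Lam (P i))%:E)%E.
Proof. by move=> AP; apply: ereal_inf_lbound; exists P. Qed.

Let daniell_le2 A (Q : nat -> nat -> M -> R) :
  (forall i j, continuous (Q i j)) -> (forall i j x, 0 <= Q i j x) ->
  (forall x, A x -> (1 <= \sum_(i <oo) \sum_(j <oo) (Q i j x)%:E)%E) ->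
  (daniell A <= \sum_(i <oo) \sum_(j <oo) (Lam (Q i j))%:E)%E.
Proof.
move=> cQ Q0 AQ; have [h hP] := nneseries_pair.
rewrite -(hP (fun i j => (Lam (Q i j))%:E)); last first.
  by move=> i j; rewrite lee_fin Lam_ge0.
apply: (@daniell_le A (fun n => Q (h n).1 (h n).2)); split => // x Ax.
by rewrite (hP (fun i j => (Q i j x)%:E)) ?AQ// => i j; rewrite lee_fin.
Qed.

Let daniell0 : daniell set0 = 0%E.
Proof.
apply/eqP; rewrite eq_le; apply/andP; split.
  have S0 : fun_cover set0 (fun _ _ => 0) by split => // i; exact: ccst.
  by apply: le_trans (daniell_le S0) _; rewrite Lam0 eseries0.
apply: le_ereal_inf_tmp => _ [P AP <-].
by apply: nneseries_ge0 => i _ _; exact: cost_ge0 AP.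
Qed.

Let daniell_ge0 A : (0 <= daniell A)%E.
Proof.
apply: le_ereal_inf_tmp => _ [P AP <-].
by apply: nneseries_ge0 => i _ _; exact: cost_ge0 AP.
Qed.

Let le_daniell : {homo daniell : A B / A `<=` B >-> (A <= B)%E}.
Proof.
move=> A B AB; apply: ereal_inf_le_tmp => _ [P [cP P0 BP] <-].
by exists P => //; split => // x /AB; exact: BP.
Qed.

(** Covers of the [A i] that are optimal up to [e / 2 ^ i.+1] together cover the union. Near-optimal
    covers need finite values, hence the separate infinite case. *)
Let daniell_sigma_subadditive : sigma_subadditive daniell.
Proof.
move=> A; apply/lee_addgt0Pr => e e0.
have [[i ioo]|/forallNP Afin] := pselect (exists i, daniell (A i) = +oo%E).
  by rewrite (eseries_pinfty _ _ ioo) ?leey// => n _;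
    rewrite -ltNye (lt_le_trans _ (daniell_ge0 _)).
have /choice[Q QA] : forall i, exists P, fun_cover (A i) P /\
    (\sum_(j <oo) (Lam (P j))%:E <= daniell (A i) + (e / (2 ^ i.+1)%:R)%:E)%E.
  move=> i; have en : 0 < e / (2 ^ i.+1)%:R by rewrite divr_gt0// ltr0n expn_gt0.
  have fi : daniell (A i) \is a fin_num.
    by rewrite ge0_fin_numE// ltey; apply/eqP; exact: Afin.
  have [_ [P AP <-] /ltW] := lb_ereal_inf_adherent en fi.
  by exists P.
apply: le_trans (epsilon_trick xpredT (fun i => daniell_ge0 (A i)) (ltW e0)).
have Q0 i j x : (0 <= (Q i j x)%:E)%E by rewrite lee_fin; have [[]] := QA i.
have Q1 i x : (0 <= \sum_(j <oo) (Q i j x)%:E)%E by exact: nneseries_ge0.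
apply: (@le_trans _ _ (\sum_(i <oo) \sum_(j <oo) (Lam (Q i j))%:E)%E).
  apply: daniell_le2.
  - by move=> i j; have [[]] := QA i.
  - by move=> i j x; rewrite -lee_fin.
  - move=> x [i _ Aix]; have [[_ _ /(_ x Aix) h] _] := QA i.
    apply: le_trans h _.
    by rewrite [leRHS](@nneseriesD1 _ _ i)// leeDl// nneseries_ge0.
apply: lee_nneseries => [i _ _|i _]; last by have [] := QA i.
by apply: nneseries_ge0 => j _ _; apply: (cost_ge0 (A := A i)); have [] := QA i.
Qed.

(** The series is finite, so it cannot exceed all its partial sums by [e]. This serves to cut off a
    series of costs at a finite index. *)
Let partial_sum (c : nat -> R) (B e : R) : (forall k, 0 <= c k) -> 0 < e ->
  (forall n, \sum_(0 <= k < n) c k <= B) ->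
  exists n, (\sum_(k <oo) (c k)%:E <= (\sum_(0 <= k < n) c k + e)%:E)%E.
Proof.
move=> c0 e0 cB.
have le_B : (\sum_(k <oo) (c k)%:E <= B%:E)%E.
  apply: lime_le; first by apply: is_cvg_nneseries => k _ _; rewrite lee_fin.
  by apply: nearW => n; rewrite sumEFin lee_fin.
apply/not_existsP => H.
have {}H n : (\sum_(0 <= k < n) (c k)%:E <= \sum_(k <oo) (c k)%:E - e%:E)%E.
  have /negP := H n; rewrite -ltNge => /ltW.
  by rewrite EFinD -sumEFin leeBrDr.
have : (\sum_(k <oo) (c k)%:E <= \sum_(k <oo) (c k)%:E - e%:E)%E.
  apply: lime_le; first by apply: is_cvg_nneseries => k _ _; rewrite lee_fin.
  exact: nearW.
have : (\sum_(k <oo) (c k)%:E)%E \is a fin_num.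
  rewrite ge0_fin_numE ?(le_lt_trans le_B) ?ltry//.
  by apply: nneseries_ge0 => k _ _; rewrite lee_fin.
move=> fs; rewrite leeBrDr// -{2}(adde0 (\sum_(k <oo) (c k)%:E)%E).
by rewrite leeD2lE// lee_fin leNgt e0.
Qed.

(* Multiplying a cover by [psi k] and [1 - psi k], with [psi k] increasing to
   the indicator of [G], splits it into covers of the two pieces. *)
Let daniell_open (G : set M) : open G -> forall E,
  (daniell (E `&` G) + daniell (E `&` ~` G) <= daniell E)%E.
Proof.
move=> oG E.
have [psi [cpsi psi00 psi_le psiG psi1]] := open_separator oG.
have psi0 k x : 0 <= psi k x.
  elim: k => [|k ih]; first by rewrite psi00.
  by have /andP[+ _] := psi_le k x; exact: le_trans.
have psi_le1 k x : psi k x <= 1.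
  by case: k => [|k]; [rewrite psi00|have /andP[] := psi_le k x].
apply: le_ereal_inf_tmp => _ [P EP <-]; have [cP P0 P1] := EP.
apply/lee_addgt0Pr => e e0.
(* The increments of [psi] split up [P i]: since [psi 0] vanishes, the sum over [k < n] telescopes
   to [P i * psi n], which is eventually [P i] on [G]. *)
pose Q i k x := P i x * (psi k.+1 x - psi k x).
have cQ i k : continuous (Q i k).
  by apply: cmul; [exact: cP|apply: csub; exact: cpsi].
have Q0 i k x : 0 <= Q i k x.
  by rewrite mulr_ge0// subr_ge0; have /andP[] := psi_le k x.
have Qtel i n x : \sum_(k < n) Q i k x = P i x * psi n x.
  rewrite -mulr_sumr; congr (_ * _).
  by rewrite -(big_mkord xpredT (fun k => psi k.+1 x - psi k x))
    telescope_sumr// psi00 subr0.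
have cPpsi i n : continuous (fun x => P i x * psi n x).
  by apply: cmul; [exact: cP|exact: cpsi].
have LQ i n : \sum_(0 <= k < n) Lam (Q i k) = Lam (fun x => P i x * psi n x).
  rewrite big_mkord -(Lam_sum n (cQ i)).1; congr Lam; apply/funext => x.
  exact: Qtel.
have Ppsi_le i n x : P i x * psi n x <= P i x.
  by rewrite ler_piMr.
(* The pieces [Q i k] from [K i] on cost at most [e / 2 ^ i.+1]. The remainder [S i] below equals
   [P i] off [G], where [psi] vanishes, and the two costs add up to that of [P i] plus this
   error. *)
have /choice[K KP] i : exists n, (\sum_(k <oo) (Lam (Q i k))%:E <=
    (\sum_(0 <= k < n) Lam (Q i k) + e / (2 ^ i.+1)%:R)%:E)%E.
  apply: (@partial_sum _ (Lam (P i))) => [k||n].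
  - exact: Lam_ge0.
  - by rewrite divr_gt0// ltr0n expn_gt0.
  - by rewrite LQ; apply: Lam_le.
have LQ0 i k : (0 <= (Lam (Q i k))%:E)%E by rewrite lee_fin Lam_ge0.
pose S i x := P i x - P i x * psi (K i) x.
have cS i : continuous (S i).
  by apply: csub; [exact: cP|exact: cPpsi].
have S0 i x : 0 <= S i x by rewrite subr_ge0.
have dG : (daniell (E `&` G) <= \sum_(i <oo) \sum_(k <oo) (Lam (Q i k))%:E)%E.
  apply: daniell_le2 => // x [Ex Gx]; apply: le_trans (P1 x Ex) _.
  apply: lee_nneseries => [i _ _|i _]; first by rewrite lee_fin.
  have [n psin] := psi1 x Gx.
  apply: le_trans (nneseries_lim_ge n _); last by move=> k _ _; rewrite lee_fin.
  by rewrite sumEFin big_mkord Qtel psin mulr1.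
have dNG : (daniell (E `&` ~` G) <= \sum_(i <oo) (Lam (S i))%:E)%E.
  apply: daniell_le; split => // x [Ex Gx]; apply: le_trans (P1 x Ex) _.
  apply: lee_nneseries => [i _ _|i _]; first by rewrite lee_fin.
  by rewrite /S psiG// mulr0 subr0.
apply: le_trans (leeD dG dNG) _.
rewrite -nneseriesD; last 2 first.
- by move=> i _ _; apply: nneseries_ge0 => k _ _.
- by move=> i _ _; rewrite lee_fin Lam_ge0.
apply: le_trans (epsilon_trick xpredT _ (ltW e0)); last first.
  by move=> i; exact: cost_ge0 EP.
apply: lee_nneseries => [i _ _|i _].
  by apply: adde_ge0; [exact: nneseries_ge0|rewrite lee_fin Lam_ge0].
apply: le_trans (leeD (KP i) (lexx _)) _.
rewrite LQ -!EFinD lee_fin LamB//.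
lra.
Qed.

(** The constant [1] is a cover of cost [1]. Conversely, a Dini argument: by compactness finitely
    many terms of any cover sum to more than [1 - e] everywhere, and [Lam] is monotone. *)
Let daniellT : daniell setT = 1%E.
Proof.
apply/eqP; rewrite eq_le; apply/andP; split.
  have S1 : fun_cover setT (fun i _ => (i == 0)%:R).
    split => [i|i x|x _].
    - exact: ccst.
    - exact: ler0n.
    - apply: le_trans (nneseries_lim_ge 1 _); last by move=> i _ _; rewrite lee_fin.
      by rewrite big_nat1.
  apply: le_trans (daniell_le S1) _.
  rewrite nneseries_recl//; last by move=> k _; exact: cost_ge0 S1.
  rewrite eseries0 ?adde0 ?Lam1// => i; case: i => // i _ _.
  by rewrite Lam0.
apply: le_ereal_inf_tmp => _ [P [cP P0 P1] <-].
apply/lee_addgt0Pr => e e0.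
have := hc; rewrite compact_near_coveringP.
move=> /(_ nat \oo (fun n x => 1 - e < \sum_(i < n) P i x) _) [].
  move=> x _.
  have [n nx] : exists n, 1 - e < \sum_(i < n) P i x.
    apply/not_existsP => H; have := P1 x I; apply/negP; rewrite -ltNge.
    apply: (@le_lt_trans _ _ (1 - e)%:E); last by rewrite lte_fin; lra.
    apply: lime_le; first by apply: is_cvg_nneseries => k _ _; rewrite lee_fin.
    apply: nearW => n; rewrite sumEFin lee_fin big_mkord leNgt; apply/negP.
    exact: H.
  have cn := (Lam_sum n cP).2.
  exists ([set y | 1 - e < \sum_(i < n) P i y], [set m | (n <= m)%N]).
    split => /=; last by exists n.
    by have /cvgr_gt := cn x; apply.
  move=> [y m] [/= ny nm]; apply: lt_le_trans ny _.
  rewrite -!(big_mkord xpredT (fun i => P i y)) [leRHS](@big_cat_nat _ _ _ n)//=.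
  by rewrite lerDl sumr_ge0.
move=> n _ /(_ n (leqnn n)) nP.
apply: (@le_trans _ _ ((\sum_(0 <= i < n) Lam (P i))%:E + e%:E)%E); last first.
  rewrite leeD2r// -sumEFin; apply: nneseries_lim_ge => i _ _.
  by rewrite lee_fin Lam_ge0.
rewrite -EFinD lee_fin -lerBlDr big_mkord -(Lam_sum n cP).1.
have -> : 1 - e = Lam (fun=> (1 - e) * 1) by rewrite (LamZ (1 - e)) ?Lam1 ?mulr1.
apply: Lam_le; [exact: ccst|exact: (Lam_sum n cP).2|move=> x].
by rewrite mulr1; apply/ltW/nP.
Qed.

(* Slice [phi] into layers of height [e]: layer [j + 1] is at most [e] times
   the indicator of [phi >= (j + 1) e], where layer [j] equals [e]. *)
Let integral_le_daniell (nu : probability M R) :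
  (forall A, measurable A -> nu A = daniell A) ->
  forall phi, continuous phi -> (forall x, 0 <= phi x) ->
    \int[nu]_x phi x <= Lam phi.
Proof.
move=> nuE phi cphi phi0; apply/ler_addgt0Pr => e e0.
have [c phic] := compact_bounded cphi.
pose N := (Num.truncn (c / e)).+1.
have phiN x : phi x <= N%:R * e.
  rewrite -ler_pdivrMr// ltW//; apply: le_lt_trans (truncnS_gt (c / e)).
  by rewrite ler_pM2r ?invr_gt0//; apply: le_trans (phic x); exact: ler_norm.
pose S (j : nat) x := Num.min (Num.max (phi x - j%:R * e) 0) e.
have cS j : continuous (S j).
  have cm : continuous (fun x => Num.max (phi x - j%:R * e) 0).
    move=> x; apply: (@continuous_max _ _ (fun x => phi x - j%:R * e) (fun=> 0)).
      by apply: csub => //; exact: ccst.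
    exact: ccst.
  move=> x.
  apply: (@continuous_min _ _ (fun x => Num.max (phi x - j%:R * e) 0) (fun=> e)).
    exact: cm.
  exact: ccst.
have SE n x : \sum_(j < n) S j x = Num.min (phi x) (n%:R * e).
  elim: n => [|n ih]; first by rewrite big_ord0 mul0r; apply/esym/min_idPr.
  rewrite big_ord_recr/= ih /S -natr1 mulrDl mul1r.
  have : 0 <= n%:R * e by rewrite mulr_ge0// ltW.
  move: (n%:R * e) => t t0; rewrite !minElt !maxElt.
  move: (phi x) => p; have -> : (p < t + e) = (p - t < e) by rewrite ltrBlDl.
  have [pt|tp] := ltP p t.
    by rewrite !ifT ?addr0 ?subr_lt0// ltrBlDl; lra.
  have -> : (p - t < 0) = false by rewrite subr_lt0 ltNge tp.
  by case: ifP => _ //; rewrite addrC subrK.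
have S0 j x : 0 <= S j x by rewrite le_min le_max lexx orbT ltW.
have Se j x : S j x <= e by rewrite ge_min lexx orbT.
have Sn j x : `|S j x| <= e by rewrite ger0_norm.
have mS j : measurable_fun setT (S j) by exact: continuous_measurable.
have iS j : nu.-integrable setT (EFin \o S j) by exact: integrable_bdd (Sn j).
have step j : \int[nu]_x S j.+1 x <= Lam (S j).
  pose F := [set x | j.+1%:R * e <= phi x].
  have mF : measurable F.
    rewrite (_ : F = setT `&` phi @^-1` `[j.+1%:R * e, +oo[%classic).
      by apply: continuous_measurable.
    by apply/seteqP; split => x /=; rewrite in_itv/= andbT => //; case.
  have nuF : (nu F <= (e^-1 * Lam (S j))%:E)%E.
    rewrite nuE// -LamZ//.
    (* On [F] the layer [S j] is full, so [S j / e], padded with zeros, is a cover. *)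
    have FP : fun_cover F
        (fun i => if i == 0%N then fun x => e^-1 * S j x else fun=> 0).
      split.
      - by case=> [|i] /=; [apply: cmul => //; exact: ccst|exact: ccst].
      - by case=> [|i] x //=; rewrite mulr_ge0// invr_ge0 ltW.
      - move=> x Fx; apply: le_trans (nneseries_lim_ge 1 _); last first.
          by case=> [|i] _ _ //=; rewrite lee_fin mulr_ge0// invr_ge0 ltW.
        rewrite big_nat1/= lee_fin mulrC ler_pdivlMr// mul1r.
        rewrite le_min lexx andbT le_max.
        by apply/orP; left; move: Fx; rewrite /F/= -natr1; lra.
    apply: le_trans (daniell_le FP) _.
    rewrite nneseries_recl//; last by move=> k _; exact: cost_ge0 FP.
    by rewrite eseries0 ?adde0// => -[|i] _ _ //=; rewrite Lam0.
  apply: (@le_trans _ _ (\int[nu]_x (e * \1_F x))).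
    apply: le_Rintegral => //.
      apply: (@integrable_bdd _ _ e).
        by apply: measurable_funM => //; exact: measurable_indic.
      move=> x; rewrite indicE; case: (_ \in _).
        by rewrite mulr1 ger0_norm// ltW.
      by rewrite mulr0 normr0 ltW.
    move=> x _; rewrite indicE; have [|xF] := boolP (x \in F).
      by rewrite mulr1.
    rewrite mulr0 ge_min; apply/orP; left.
    rewrite ge_max lexx andbT subr_le0 leNgt.
    by apply/negP => /ltW h; move/negP: xF; apply; rewrite inE.
  rewrite RintegralZl//; last exact: integrable_indic.
  rewrite /Rintegral integral_indic// setIT mulrC -ler_pdivlMr// mulrC.
  by rewrite -lee_fin fineK// fin_num_measure.
rewrite (_ : phi = fun x => \sum_(j < N.+1) S j x); last first.
  apply/funext => x; rewrite SE; apply/esym/min_idPl; apply: le_trans (phiN x) _.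
  by rewrite ler_wpM2r ?ler_nat// ltW.
(* Layer [0] has no layer below it to be compared with; its integral is at most [e], the allowed
   error. *)
rewrite Rintegral_sum// big_ord_recl addrC; apply: lerD; last first.
  rewrite -[leRHS](Rintegral_prob_cst nu); apply: le_Rintegral => //.
  exact: integrable_cst.
apply: (@le_trans _ _ (\sum_(j < N) Lam (S j))).
  by apply: ler_sum => j _; exact: step.
rewrite -(Lam_sum N cS).1; apply: Lam_le.
- exact: (Lam_sum N cS).2.
- exact: (Lam_sum N.+1 cS).2.
- by move=> x; rewrite [leRHS]big_ord_recr/= lerDl.
Qed.

(** Open sets are Caratheodory measurable for [daniell], hence so are all Borel sets, and the
    restriction to them is a probability measure. *)
Lemma riesz_representation :
  exists nu : probability M R,
    forall phi, continuous phi -> \int[nu]_x phi x = Lam phi.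
Proof.
pose om : {outer_measure set M -> \bar R} := HB.pack daniell
  (@isOuterMeasure.Build R M daniell daniell0 daniell_ge0 le_daniell
     daniell_sigma_subadditive).
have mo : @measurable d M `<=` om.-caratheodory.
  rewrite hb; apply: smallest_sub.
    split.
    - exact: caratheodory_measurable_set0.
    - by move=> A mA; rewrite setTD; exact: caratheodory_measurable_setC.
    - exact: caratheodory_measurable_bigcup.
  move=> G oG; apply: le_caratheodory_measurable => E; exact: daniell_open.
have sa : semi_sigma_additive (daniell : set M -> \bar R).
  move=> F mF tF mUF.
  apply: (@caratheodory_measure_sigma_additive R M om F) => //.
    by move=> i; exact: mo.
  exact: mo.
pose m : {measure set M -> \bar R} := HB.pack daniell
  (@isMeasure.Build d M R daniell daniell0 daniell_ge0 sa).
have [nu nuE] := probability_of_measure (m := m) daniellT.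
exists nu => phi cphi.
have nu_le phi0 : continuous phi0 -> (forall x, 0 <= phi0 x) ->
    \int[nu]_x phi0 x <= Lam phi0.
  by move=> c0 p0; apply: integral_le_daniell => // A _; exact: nuE.
have [c phic] := compact_bounded cphi.
have inu : nu.-integrable setT (EFin \o phi).
  by apply: integrable_bdd phic; exact: continuous_measurable.
have icst := integrable_cst nu c.
have Icst := Rintegral_prob_cst nu c.
have LamC : Lam (fun=> c) = c.
  rewrite -[RHS]mulr1 -Lam1 -LamZ; last exact: ccst.
  by congr Lam; apply/funext => x; rewrite mulr1.
have cphi' x : - c <= phi x <= c by rewrite -ler_norml.
(* The one-sided bound is applied to the nonnegative functions [phi + c] and [c - phi]; both
   functionals agree on constants, so equality follows. *)
apply/eqP; rewrite eq_le; apply/andP; split.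
  rewrite -(lerD2r c) -{1}Icst -RintegralD// -{2}LamC -LamD//.
  apply: nu_le => [x|x]; first by apply: cvgD; [exact: cphi|exact: ccst].
  by have := cphi' x; rewrite /=; lra.
rewrite -lerN2 -(lerD2l c) -{1}Icst -{2}LamC -RintegralB// -LamB//.
apply: nu_le => [|x]; first exact: csub.
by have := cphi' x; lra.
Qed.
End riesz.

(** * Weak sequential compactness of probability densities *)

(** Along the extracted subsequence, the limit of the integrals is a positive normalized linear
    functional on continuous functions, hence an integral. *)
Lemma density_weak_compactness (mu : probability M R) (f_ : nat -> M -> R) :
  (forall n, prob_density mu (f_ n)) ->
  exists2 s : nat -> nat, {homo s : m n / (m < n)%N} &
    exists nu : probability M R, forall phi : M -> R, continuous phi ->
      \int[mu]_x (phi x * f_ (s n) x) @[n --> \oo] --> \int[nu]_x phi x.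
Proof.
move=> fd; have [s s_lt cs] := density_extraction fd.
exists s => //.
pose Lam (phi : M -> R) : R := limn (fun n => \int[mu]_x (phi x * f_ (s n) x)).
have ip (phi : M -> R) n : continuous phi ->
    mu.-integrable setT (EFin \o (fun x => phi x * f_ (s n) x)).
  move=> cphi; have [c phic] := compact_bounded cphi.
  by apply: integrable_bddM phic; [case: (fd (s n))|exact: continuous_measurable].
have [||||nu nuE] := @riesz_representation Lam.
- move=> phi psi cphi cpsi; apply/cvg_lim => //.
  under eq_fun do under eq_Rintegral do rewrite mulrDl.
  under eq_fun do rewrite RintegralD ?ip//.
  by apply: cvgD; [exact: cs|exact: cs].
- move=> c phi cphi; apply/cvg_lim => //.
  under eq_fun do under eq_Rintegral do rewrite -mulrA.
  under eq_fun do rewrite RintegralZl ?ip//.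
  by apply: cvgM; [exact: cvg_cst|exact: cs].
- move=> phi cphi phi0; apply: limr_ge; first exact: cs.
  apply: nearW => n; apply: Rintegral_ge0 => x _.
  by rewrite mulr_ge0//; case: (fd (s n)).
- apply/cvg_lim => //.
  under eq_fun do rewrite (density_cst 1 (fd (s _))).
  exact: cvg_cst.
- by exists nu => phi cphi; rewrite nuE//; exact: cs.
Qed.

(** * Free energy and its minimizers *)

Section potential.
Variables (mu : probability M R) (u : R -> R) (C L : R).
Hypotheses (L0 : 0 < L) (uC : forall t, 0 <= t -> 0 <= u t <= C).
Hypothesis uL : forall t1 t2, 0 <= t1 -> 0 <= t2 ->
  `|u t1 - u t2| <= L * `|t1 - t2|.
Implicit Types f h : M -> R.

Lemma kernel_lip (x y z : M) : `|u (mdist x y) - u (mdist x z)| <= L * mdist y z.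
Proof.
apply: le_trans (uL (mdist_ge0 _ _) (mdist_ge0 _ _)) _.
by rewrite ler_pM2l// mdist_dist.
Qed.

Lemma continuous_kernel (x : M) : continuous (fun y => u (mdist x y)).
Proof.
by apply: lipschitz_metric_continuous; exists L; [exact: ltW|exact: kernel_lip].
Qed.

Lemma measurable_kernel (x : M) : measurable_fun setT (fun y => u (mdist x y)).
Proof. exact/continuous_measurable/continuous_kernel. Qed.

Lemma kernel_bound (x y : M) : `|u (mdist x y)| <= C.
Proof. by have /andP[u0 u1] := uC (mdist_ge0 x y); rewrite ger0_norm. Qed.

Lemma potential_ge0 f x : prob_density mu f -> 0 <= potential mu u f x.
Proof.
move=> [_ f0 _]; apply: Rintegral_ge0 => y _; apply: mulr_ge0 => //.
by have /andP[] := uC (mdist_ge0 x y).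
Qed.

Lemma potential_bound f x : prob_density mu f -> `|potential mu u f x| <= C.
Proof.
by move=> fd; apply: density_bound => //;
  [exact: measurable_kernel|exact: kernel_bound].
Qed.

Lemma integrable_kernelM f x : mu.-integrable setT (EFin \o f) ->
  mu.-integrable setT (EFin \o (fun y => u (mdist x y) * f y)).
Proof.
by move=> fi; apply: integrable_bddM (kernel_bound x) => //;
  exact: measurable_kernel.
Qed.

Lemma potential_lip f x y : prob_density mu f ->
  `|potential mu u f x - potential mu u f y| <= L * mdist x y.
Proof.
move=> fd; have [fi _ _] := fd.
rewrite /potential -RintegralB//; [|exact: integrable_kernelM..].
under eq_Rintegral do rewrite -mulrBl.
apply: density_bound => //.
  by apply: measurable_funB; exact: measurable_kernel.
by move=> z; rewrite (metric_sym x z) (metric_sym y z); exact: kernel_lip.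
Qed.

Lemma lipschitz_potential f : prob_density mu f ->
  lipschitz_metric (potential mu u f).
Proof. by exists L; [exact: ltW|move=> x y; exact: potential_lip]. Qed.

Lemma measurable_potential f : prob_density mu f ->
  measurable_fun setT (potential mu u f).
Proof.
by move=> fd; exact/continuous_measurable/lipschitz_metric_continuous/lipschitz_potential.
Qed.

(* Riemann sums over a fine partition replace Fubini's theorem, which would
   need joint measurability of the kernel. *)
Lemma potential_sym f h : prob_density mu f -> prob_density mu h ->
  \int[mu]_x (potential mu u f x * h x) = \int[mu]_x (potential mu u h x * f x).
Proof.
move=> fd hd; have [fi _ _] := fd.
apply/eqP; rewrite -subr_eq0 -normr_le0; apply/ler_addgt0Pl => e e0.
rewrite addr0.
have r0 : 0 < e / (2 * L) by rewrite divr_gt0// mulr_gt0.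
have [N [x [j [jN xj mj]]]] := quantizer r0.
have xj' y : L * mdist y (x (j y)) <= e / 2.
  have := xj y; rewrite ltr_pdivlMr ?mulr_gt0// metric_sym => /ltW; lra.
(* With [m i] the [h]-mass of cell [i], the sum of [potential mu u f (x i) * m i] is within [e / 2]
   of both sides: one quantizes the potential of [f], the other the kernel inside the potential of
   [h]. *)
pose m (i : nat) := \int[mu]_y (\1_[set y | j y = i] y * h y).
have A1 := quantized_integral hd (measurable_potential fd)
  (fun y => potential_bound y fd) jN mj
  (fun y => le_trans (potential_lip y (x (j y)) fd) (xj' y)).
have A2 (y : M) :
    `|potential mu u h y - \sum_(i < N) u (mdist (x i) y) * m i| <= e / 2.
  under eq_bigr do rewrite metric_sym.
  by apply: (quantized_integral hd (measurable_kernel y) (kernel_bound y) jN mj)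
    => z; apply: le_trans (kernel_lip _ _ _) (xj' z).
have ms : measurable_fun setT (fun y => \sum_(i < N) u (mdist (x i) y) * m i).
  apply: measurable_sum => i; apply: measurable_funM => //.
  exact: measurable_kernel.
have E : \sum_(i < N) potential mu u f (x i) * m i =
    \int[mu]_y ((\sum_(i < N) u (mdist (x i) y) * m i) * f y).
  under [RHS]eq_Rintegral do rewrite mulr_suml.
  under [RHS]eq_Rintegral do under eq_bigr do rewrite mulrAC.
  rewrite Rintegral_sum//; last first.
    move=> i; apply: (@eq_integrable _ _ _ mu _ measurableT _ _ (fun _ _ => erefl)).
    exact: (integrableZr measurableT (m i) (integrable_kernelM (x i) fi)).
  by apply: eq_bigr => i _; rewrite RintegralZr//; exact: integrable_kernelM.
have bs y : `|\sum_(i < N) u (mdist (x i) y) * m i| <= C + e / 2.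
  have := A2 y; have := potential_bound y hd.
  rewrite !ler_norml; lra.
have A3 : `|\int[mu]_y (potential mu u h y * f y) -
    \sum_(i < N) potential mu u f (x i) * m i| <= e / 2.
  rewrite E -RintegralB//.
  - under eq_Rintegral do rewrite -mulrBl.
    apply: density_bound => //; apply: measurable_funB => //.
    exact: measurable_potential.
  - apply: integrable_bddM (fun y => potential_bound y hd) => //.
    exact: measurable_potential.
  - exact: integrable_bddM bs.
move: A1 A3; rewrite -/m !ler_norml; lra.
Qed.

Lemma pos_normalized_density f : pos_normalized mu f -> prob_density mu f.
Proof.
move=> [mf f0 f1]; split => //; last by move=> x; exact/ltW.
apply/integrableP; split; first exact/measurable_EFinP.
under eq_integral do rewrite /= ger0_norm ?ltW//.
by rewrite f1 ltry.
Qed.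

Lemma dominated_Rintegral (F_ : nat -> M -> R) (F : M -> R) (c : R) :
  (forall n, measurable_fun setT (F_ n)) -> measurable_fun setT F ->
  (forall n x, `|F_ n x| <= c) ->
  (forall x, F_ n x @[n --> \oo] --> F x) ->
  \int[mu]_x F_ n x @[n --> \oo] --> \int[mu]_x F x.
Proof.
move=> mF_ mF bF cF.
have [|||||iF _ h] := @dominated_convergence _ M R mu setT measurableT
   (fun n => EFin \o F_ n) (EFin \o F) (EFin \o (fun=> c)).
- by move=> n; exact/measurable_EFinP.
- exact/measurable_EFinP.
- by apply: nearW => x _; apply: cvg_EFin; [exact: nearW|exact: cF].
- exact: integrable_cst.
- by apply: nearW => x n _; rewrite /= lee_fin.
apply: fine_cvg; rewrite fineK; first exact: h.
exact: integrable_fin_num iF.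
Qed.

(** * Gibbs densities *)

Definition partition (b : R) (V : M -> R) : R := \int[mu]_x expR (- b * V x).

(** [V] is arbitrary because the limit of potentials along a minimizing sequence is identified as a
    potential only after its Gibbs density has been formed. *)
Definition gibbs (b : R) (V : M -> R) (x : M) : R :=
  (partition b V)^-1 * expR (- b * V x).

Section gibbs.
Variables (b : R) (V : M -> R).
Hypotheses (b0 : 0 <= b) (mV : measurable_fun setT V).
Hypothesis VC : forall x, 0 <= V x <= C.

Let mw : measurable_fun setT (fun x => expR (- b * V x)).
Proof.
by apply: measurableT_comp => //; exact: measurable_funM.
Qed.

Lemma gibbs_weight x : expR (- b * C) <= expR (- b * V x) <= 1.
Proof.
have /andP[V0 V1] := VC x.
rewrite -[X in _ <= _ <= X]expR0 !ler_expR !mulNr lerN2 oppr_le0.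
by rewrite ler_wpM2l// mulr_ge0.
Qed.

Let wn x : `|expR (- b * V x)| <= 1.
Proof. by rewrite ger0_norm ?expR_ge0//; have /andP[] := gibbs_weight x. Qed.

Lemma partition_bound : expR (- b * C) <= partition b V <= 1.
Proof.
have iw := integrable_bdd mu mw wn.
apply/andP; split.
  rewrite -[leLHS](Rintegral_prob_cst mu); apply: le_Rintegral => //.
    exact: integrable_cst.
  by move=> x _; have /andP[] := gibbs_weight x.
rewrite -[leRHS](Rintegral_prob_cst mu); apply: le_Rintegral => //.
  exact: integrable_cst.
by move=> x _; have /andP[] := gibbs_weight x.
Qed.

Lemma partition_gt0 : 0 < partition b V.
Proof. by have /andP[+ _] := partition_bound; apply: lt_le_trans (expR_gt0 _). Qed.

Lemma gibbs_gt0 x : 0 < gibbs b V x.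
Proof. by rewrite mulr_gt0// ?invr_gt0 ?partition_gt0 ?expR_gt0. Qed.

Lemma measurable_gibbs : measurable_fun setT (gibbs b V).
Proof. exact: measurable_funM. Qed.

Lemma gibbs_bound x : `|gibbs b V x| <= expR (b * C).
Proof.
rewrite gtr0_norm ?gibbs_gt0// -[leRHS]mulr1 ler_pM ?invr_ge0 ?expR_ge0//.
- exact/ltW/partition_gt0.
- rewrite -[leRHS]invrK -expRN -mulNr lef_pV2 ?posrE ?partition_gt0 ?expR_gt0//.
  by have /andP[] := partition_bound.
- by have /andP[] := gibbs_weight x.
Qed.

Lemma gibbs_normalized : pos_normalized mu (gibbs b V).
Proof.
split; [exact: measurable_gibbs|exact: gibbs_gt0|].
have iw := integrable_bdd mu mw wn.
have ig : mu.-integrable setT (EFin \o gibbs b V).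
  exact: (integrable_bdd mu measurable_gibbs gibbs_bound).
rewrite -(fineK (integrable_fin_num _ ig))// -[fine _]/(\int[mu]_x gibbs b V x).
by rewrite RintegralZl// mulVf// gt_eqF// partition_gt0.
Qed.

Lemma gibbs_density : prob_density mu (gibbs b V).
Proof. exact/pos_normalized_density/gibbs_normalized. Qed.

Lemma ln_gibbs x : ln (gibbs b V x) = - ln (partition b V) - b * V x.
Proof.
rewrite /gibbs lnM ?posrE ?invr_gt0 ?partition_gt0 ?expR_gt0//.
by rewrite lnV ?posrE ?partition_gt0// expRK mulNr.
Qed.

Lemma ln_gibbs_bound : exists c, forall x, `|ln (gibbs b V x)| <= c.
Proof.
exists (`|ln (partition b V)| + b * C) => x; rewrite ln_gibbs.
apply: le_trans (ler_normB _ _) _; rewrite normrN lerD2l normrM ger0_norm//.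
by rewrite ler_wpM2l//; have /andP[V0 V1] := VC x; rewrite ger0_norm.
Qed.

Lemma measurable_ln_gibbs : measurable_fun setT (fun x => ln (gibbs b V x)).
Proof. exact: measurableT_comp measurable_gibbs. Qed.

Lemma integrable_ln_gibbs f : prob_density mu f ->
  mu.-integrable setT (EFin \o (fun x => ln (gibbs b V x) * f x)).
Proof.
move=> [fi _ _]; have [c gc] := ln_gibbs_bound.
exact: integrable_bddM fi measurable_ln_gibbs gc.
Qed.

Lemma Rintegral_ln_gibbs f : prob_density mu f ->
  \int[mu]_x (ln (gibbs b V x) * f x) =
  - ln (partition b V) - b * \int[mu]_x (V x * f x).
Proof.
move=> fd; have [fi _ _] := fd.
have Vn x : `|V x| <= C by have /andP[V0 V1] := VC x; rewrite ger0_norm.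
under eq_Rintegral do rewrite ln_gibbs mulrBl -mulrA.
have iV := integrable_bddM fi mV Vn.
have iZ : mu.-integrable setT (EFin \o (fun x => - ln (partition b V) * f x)).
  exact: (integrableZl measurableT (- ln (partition b V)) fi).
have ibV : mu.-integrable setT (EFin \o (fun x => b * (V x * f x))).
  exact: (integrableZl measurableT b iV).
by rewrite RintegralB// density_cst// RintegralZl.
Qed.

End gibbs.

(** * Interaction, entropy and finite energy *)

Definition pairing f h : R := \int[mu]_x (potential mu u f x * h x).

Definition entropy f : R := \int[mu]_x (f x * ln (f x)).

Definition energy (b : R) f : R := entropy f + b / 2 * pairing f f.

(** For [b >= 0], the competitors of finite free energy: the interaction is bounded, so only the
    entropy can be infinite. *)
Definition admissible f :=
  pos_normalized mu f /\ mu.-integrable setT (EFin \o (fun x => f x * ln (f x))).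

Lemma potential_itv f x : prob_density mu f -> 0 <= potential mu u f x <= C.
Proof.
move=> fd; rewrite potential_ge0//=.
by apply: le_trans (potential_bound x fd); exact: ler_norm.
Qed.

Lemma integrable_potentialM f h : prob_density mu f ->
  mu.-integrable setT (EFin \o h) ->
  mu.-integrable setT (EFin \o (fun x => potential mu u f x * h x)).
Proof.
move=> fd hi; apply: integrable_bddM hi (measurable_potential fd) _ => x.
exact: potential_bound.
Qed.

Lemma pairing_itv f h : prob_density mu f -> prob_density mu h ->
  0 <= pairing f h <= C.
Proof.
move=> fd hd; have [_ h0 _] := hd; apply/andP; split.
  by apply: Rintegral_ge0 => x _; rewrite mulr_ge0// potential_ge0.
apply: le_trans (ler_norm _) _; apply: density_bound hd _ _ => [|x].
  exact: measurable_potential.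
exact: potential_bound.
Qed.

Lemma gibbs_admissible (b : R) (V : M -> R) : 0 <= b -> measurable_fun setT V ->
  (forall x, 0 <= V x <= C) -> admissible (gibbs b V).
Proof.
move=> b0 mV VC; split; first exact: gibbs_normalized.
rewrite (_ : (fun x => _) = (fun x => ln (gibbs b V x) * gibbs b V x)).
  exact/integrable_ln_gibbs/gibbs_density.
by apply/funext => x; rewrite mulrC.
Qed.

(** * Energy along convex combinations *)

Definition mix (t : R) f h x : R := (1 - t) * f x + t * h x.

Section mix.
Variables (t : R) (f h : M -> R).
Hypotheses (t01 : 0 <= t <= 1).

Let iscale (k : R) (p : M -> R) : mu.-integrable setT (EFin \o p) ->
  mu.-integrable setT (EFin \o (fun x => k * p x)).
Proof. by move=> ip; exact: (integrableZl measurableT k ip). Qed.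

Lemma Rintegral_mix (p q : M -> R) : mu.-integrable setT (EFin \o p) ->
  mu.-integrable setT (EFin \o q) ->
  \int[mu]_x ((1 - t) * p x + t * q x) =
  (1 - t) * \int[mu]_x p x + t * \int[mu]_x q x.
Proof.
by move=> ip iq; rewrite RintegralD//; [rewrite !RintegralZl//|exact: iscale..].
Qed.

Let integrable_mix (p q : M -> R) : mu.-integrable setT (EFin \o p) ->
  mu.-integrable setT (EFin \o q) ->
  mu.-integrable setT (EFin \o (fun x => (1 - t) * p x + t * q x)).
Proof.
move=> ip iq.
exact: (integrableD measurableT (iscale (1 - t) ip) (iscale t iq)).
Qed.

Lemma mix_normalized : pos_normalized mu f -> pos_normalized mu h ->
  pos_normalized mu (mix t f h).
Proof.
move=> fp hp; have [mf f0 _] := fp; have [mh h0 _] := hp.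
have /andP[t0 t1] := t01.
have fd := pos_normalized_density fp; have hd := pos_normalized_density hp.
have [fi _ _] := fd; have [hi _ _] := hd.
split.
- by apply: measurable_funD; apply: measurable_funM.
- move=> x; rewrite /mix; have [->|tn1] := eqVneq t 1.
    by rewrite subrr mul0r add0r mul1r.
  have t1' : t < 1 by rewrite lt_neqAle tn1.
  by apply: ltr_pwDl; [rewrite mulr_gt0// subr_gt0|rewrite mulr_ge0// ltW].
- rewrite -(fineK (integrable_fin_num _ (integrable_mix fi hi)))//.
  rewrite -[fine _]/(\int[mu]_x ((1 - t) * f x + t * h x)) Rintegral_mix//.
  by rewrite !Rintegral_density// !mulr1 subrK.
Qed.

Let mix_convex x : 0 < f x -> 0 < h x ->
  mix t f h x * ln (mix t f h x) <=
  (1 - t) * (f x * ln (f x)) + t * (h x * ln (h x)).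
Proof. by move=> f0 h0; exact: xlnx_convex. Qed.

(** With [z] the mixture, [z ln z] lies between [z - 1 >= -1] and the integrable convex combination
    [B], so [1 + |B|] dominates it. *)
Lemma mix_admissible : admissible f -> admissible h -> admissible (mix t f h).
Proof.
move=> [fp fe] [hp he]; have mp := mix_normalized fp hp; split => //.
have [mm m0 _] := mp; have [_ f0 _] := fp; have [_ h0 _] := hp.
pose B x := (1 - t) * (f x * ln (f x)) + t * (h x * ln (h x)).
have iB : mu.-integrable setT (EFin \o (fun x => 1 + `|B x|)).
  have := integrable_norm (integrable_mix fe he).
  by move=> /(integrableD measurableT (integrable_cst mu 1)).
apply: le_integrable iB => //.
  apply/measurable_EFinP; apply: measurable_funM => //.
  by apply: measurableT_comp mm.
move=> x _; rewrite /= lee_fin [leRHS]ger0_norm ?addr_ge0//.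
have := mix_convex (f0 x) (h0 x); rewrite -/(B x).
have := xlnx_ge (m0 x); have := m0 x; have := ler_norm (B x).
have := normr_ge0 (B x); rewrite ler_norml.
lra.
Qed.

Lemma entropy_mix : admissible f -> admissible h ->
  entropy (mix t f h) <= (1 - t) * entropy f + t * entropy h.
Proof.
move=> fa ha; have [[_ f0 _] fe] := fa; have [[_ h0 _] he] := ha.
rewrite -Rintegral_mix//; apply: le_Rintegral => //.
- by have [] := mix_admissible fa ha.
- exact: integrable_mix.
- by move=> x _; exact: mix_convex.
Qed.

(** The two mixed terms of the bilinear expansion coincide by [potential_sym]. *)
Lemma pairing_mix : prob_density mu f -> prob_density mu h ->
  pairing (mix t f h) (mix t f h) = pairing f f +
    2 * t * (pairing f h - pairing f f) +
    t ^+ 2 * (pairing f f - 2 * pairing f h + pairing h h).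
Proof.
move=> fd hd; have [fi _ _] := fd; have [hi _ _] := hd.
have Um x : potential mu u (mix t f h) x =
    (1 - t) * potential mu u f x + t * potential mu u h x.
  rewrite /potential -Rintegral_mix; [|exact: integrable_kernelM..].
  by apply: eq_Rintegral => y _; rewrite /mix; ring.
have -> : pairing (mix t f h) (mix t f h) =
    \int[mu]_x ((1 - t) * ((1 - t) * (potential mu u f x * f x) +
                             t * (potential mu u f x * h x)) +
                 t * ((1 - t) * (potential mu u h x * f x) +
                        t * (potential mu u h x * h x))).
  by apply: eq_Rintegral => y _; rewrite Um /mix; ring.
rewrite Rintegral_mix; [|by apply: integrable_mix; exact: integrable_potentialM..].
rewrite !Rintegral_mix; [|exact: integrable_potentialM..].
rewrite (potential_sym hd fd) -/(pairing f f) -/(pairing f h) -/(pairing h h).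
ring.
Qed.

End mix.

Lemma pairing_integrable f : prob_density mu f ->
  mu.-integrable setT (EFin \o (fun x => potential mu u f x * f x)).
Proof. by move=> fd; have [fi _ _] := fd; exact: integrable_potentialM. Qed.

Lemma free_energyE (b : R) f : admissible f ->
  free_energy mu u b f = (energy b f)%:E.
Proof.
move=> [fp fe]; have fd := pos_normalized_density fp.
have iU := pairing_integrable fd.
have ibU : mu.-integrable setT
    (EFin \o (fun x => b / 2 * (potential mu u f x * f x))).
  exact: (integrableZl measurableT (b / 2) iU).
have E : (fun x => (ln (f x) + b / 2 * potential mu u f x) * f x) =
    (fun x => f x * ln (f x) + b / 2 * (potential mu u f x * f x)).
  by apply/funext => x; ring.
rewrite /free_energy; under eq_integral do rewrite [X in X%:E](congr1 (@^~ _) E).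
rewrite -(fineK (integrable_fin_num _ (integrableD measurableT fe ibU)))//.
rewrite -[fine _]/(\int[mu]_x
  (f x * ln (f x) + b / 2 * (potential mu u f x * f x))).
by rewrite RintegralD// RintegralZl.
Qed.

(** The integrand is at least [-1], so its negative part has finite integral. Were the positive part
    integrable too, subtracting the interaction would make [f ln f] integrable. *)
Lemma free_energy_not_admissible (b : R) f : 0 <= b -> pos_normalized mu f ->
  ~ admissible f -> free_energy mu u b f = +oo%E.
Proof.
move=> b0 fp nfa; have fd := pos_normalized_density fp.
have [mf f0 _] := fp.
pose F x := (ln (f x) + b / 2 * potential mu u f x) * f x.
have mF : measurable_fun setT F.
  apply: measurable_funM => //; apply: measurable_funD.
    exact: measurableT_comp mf.
  by apply: measurable_funM => //; exact: measurable_potential.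
have F1 x : - 1 <= F x.
  have := xlnx_ge (f0 x); rewrite /F mulrDl [ln _ * _]mulrC => h.
  have : 0 <= b / 2 * potential mu u f x * f x.
    by rewrite mulr_ge0 ?(ltW (f0 x))// mulr_ge0 ?divr_ge0// potential_ge0.
  have := f0 x; lra.
have mEF : measurable_fun setT (EFin \o F) by exact/measurable_EFinP.
have nF : (\int[mu]_x (EFin \o F)^\- x <= 1)%E.
  rewrite -[leRHS](fineK (x := 1%E))// -[fine 1%E](Rintegral_prob_cst mu).
  rewrite fineK; last exact: (integrable_fin_num measurableT (integrable_cst mu 1)).
  apply: ge0_le_integral => //; first exact: measurable_funeneg.
  move=> x _; rewrite funenegE ge_max/= !lee_fin ler01 andbT.
  by have := F1 x; lra.
have pF : (\int[mu]_x (EFin \o F)^\+ x = +oo)%E.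
  apply/eqP; rewrite -leye_eq leNgt; apply/negP => pF; apply: nfa; split => //.
  have iF : mu.-integrable setT (EFin \o F).
    apply/integrableP; split => //.
    rewrite (_ : (fun x => _) = (fun x => (EFin \o F)^\+ x + (EFin \o F)^\- x)%E).
      rewrite ge0_integralD//; [|exact: measurable_funepos|exact: measurable_funeneg].
      by rewrite lte_add_pinfty// (le_lt_trans nF) ?ltry.
    by rewrite -[LHS]/(abse \o (EFin \o F)) fune_abse.
  have ibU : mu.-integrable setT
      (EFin \o (fun x => b / 2 * (potential mu u f x * f x))).
    exact: (integrableZl measurableT (b / 2) (pairing_integrable fd)).
  rewrite (_ : (fun x => _) = (fun x => F x - b / 2 * (potential mu u f x * f x))).
    exact: (integrableB measurableT iF ibU).
  by apply/funext => x; rewrite /F; ring.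
rewrite /free_energy -/(F _) [LHS]integralE pF addye//.
have : (0 <= \int[mu]_x (EFin \o F)^\- x)%E by exact: integral_ge0.
by move: nF; case: (\int[mu]_x _)%E.
Qed.

(** * Near-minimizers and their Gibbs densities *)

Section near_minimizer.
Variables (b K : R) (f : M -> R).
Hypotheses (b0 : 0 <= b) (fa : admissible f).
Hypothesis K_le : forall h, admissible h -> K <= energy b h.

Let fp : pos_normalized mu f. Proof. by case: fa. Qed.
Let fd : prob_density mu f. Proof. exact: pos_normalized_density. Qed.
Let mU := measurable_potential fd.
Let UC x := potential_itv x fd.
Let g := gibbs b (potential mu u f).
Let Z := partition b (potential mu u f).
Let ga : admissible g. Proof. exact: gibbs_admissible. Qed.
Let gd : prob_density mu g. Proof. exact: gibbs_density. Qed.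
Let C0 : 0 <= C. Proof. by apply: le_trans (potential_bound point fd). Qed.

(* Moving from [f] towards [g] changes the energy at first order by minus the
   relative entropy of [f] with respect to [g]. *)
Lemma relative_entropy_small (t : R) : 0 < t <= 1 -> energy b f <= K + t ^+ 2 ->
  entropy f + b * pairing f f + ln Z <= t * (1 + b * C).
Proof.
move=> /andP[t0 t1] fK.
have t01 : 0 <= t <= 1 by rewrite ltW.
have := K_le (mix_admissible t01 fa ga).
have := entropy_mix t01 fa ga.
have -> : entropy g = - ln Z - b * pairing f g.
  rewrite -(Rintegral_ln_gibbs b0 mU UC gd); apply: eq_Rintegral => x _.
  by rewrite mulrC.
move=> eK KM; move: fK KM; rewrite /energy pairing_mix//.
have /andP[ff0 ffC] := pairing_itv fd fd.
have /andP[fg0 fgC] := pairing_itv fd gd.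
have /andP[gg0 ggC] := pairing_itv gd gd.
set ef := entropy f in eK *; set et := entropy _ in eK *; set l := ln Z in eK *.
set x := pairing f f in ff0 ffC eK *; set y := pairing f g in fg0 fgC eK *.
set z := pairing g g in gg0 ggC *.
(* At first order in [t] the terms in [y] cancel, leaving [- t (ef + b x + l)]. The energy of the
   mixture is at least [K], so this decrease is at most [t ^+ 2] plus the second-order term, where
   [x, z <= C] and [y >= 0]. *)
move=> H1 H2; rewrite -(ler_pM2l t0).
have q : t ^+ 2 * (b / 2 * (x - 2 * y + z)) <= t ^+ 2 * (b * C).
  rewrite ler_wpM2l ?sqr_ge0// -mulrA ler_wpM2l//; lra.
have -> : t * (t * (1 + b * C)) = t ^+ 2 + t ^+ 2 * (b * C) by ring.
have -> : t * (ef + b * x + l) = t * ef + t * b * x + t * l by ring.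
have eK' : et <= ef - t * ef - t * l - t * b * y by move: eK; lra.
have H2' : K <= et + b / 2 * x + t * b * (y - x) +
    t ^+ 2 * (b / 2 * (x - 2 * y + z)).
  by move: H2; lra.
lra.
Qed.

(** With [t = lam ^+ 2] the excess is [t ^+ 2], so the relative entropy is of order [lam ^+ 2].
    Dividing it by [lam] in [dist_le_entropy] leaves order [lam]; the term [2 * lam * y] adds [2] to
    the constant. *)
Lemma dist_gibbs_le (lam : R) : 0 < lam <= 1 / 2 -> energy b f <= K + lam ^+ 4 ->
  \int[mu]_x `|f x - g x| <= lam * (3 + b * C).
Proof.
move=> /andP[l0 l1] fK.
have [mf f0 _] := fp; have [fi _ _] := fd; have [gi _ _] := gd.
have fe : mu.-integrable setT (EFin \o (fun x => f x * ln (f x))) by case: fa.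
have igf := integrable_ln_gibbs b0 mU UC fd.
pose D x := f x * ln (f x) - ln (g x) * f x - (f x - g x).
have ifg : mu.-integrable setT (EFin \o (fun x => f x - g x)).
  exact: (integrableB measurableT fi gi).
have iD1 : mu.-integrable setT
    (EFin \o (fun x => f x * ln (f x) - ln (g x) * f x)).
  exact: (integrableB measurableT fe igf).
have iD : mu.-integrable setT (EFin \o D).
  exact: (integrableB measurableT iD1 ifg).
have ID : \int[mu]_x D x <= lam ^+ 2 * (1 + b * C).
  rewrite (RintegralB measurableT iD1 ifg) (RintegralB measurableT fe igf).
  rewrite (RintegralB measurableT fi gi) (Rintegral_density fd).
  rewrite (Rintegral_density gd) subrr subr0.
  rewrite (Rintegral_ln_gibbs b0 mU UC fd).
  have t1 : 0 < lam ^+ 2 <= 1.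
    by rewrite exprn_gt0//= expr_le1 ?ltW//; lra.
  have := relative_entropy_small t1; rewrite -exprM => /(_ fK).
  by rewrite /entropy -/Z -/(pairing f f); lra.
have iDl : mu.-integrable setT (EFin \o (fun x => lam^-1 * D x)).
  exact: (integrableZl measurableT lam^-1 iD).
have igl : mu.-integrable setT (EFin \o (fun x => 2 * lam * g x)).
  exact: (integrableZl measurableT (2 * lam) gi).
apply: (@le_trans _ _ (\int[mu]_x (lam^-1 * D x + 2 * lam * g x))).
  apply: le_Rintegral => //; first exact: integrable_norm.
    exact: (integrableD measurableT iDl igl).
  move=> x _; have := dist_le_entropy (f0 x) (gibbs_gt0 b0 mU UC x) l0 l1.
  rewrite /D -/(g x) mulrC [ln _ * _]mulrC.
  by congr (_ <= _ + _); congr (_ * _); ring.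
rewrite (RintegralD measurableT iDl igl) (RintegralZl lam^-1 measurableT iD).
rewrite (RintegralZl (2 * lam) measurableT gi) (Rintegral_density gd) mulr1.
have : lam^-1 * \int[mu]_x D x <= lam^-1 * (lam ^+ 2 * (1 + b * C)).
  by rewrite ler_wpM2l// invr_ge0 ltW.
rewrite expr2 -mulrA mulKf ?gt_eqF//; lra.
Qed.

(** Nonnegativity of the relative entropy of [f] with respect to [g]. The bound contains no entropy,
    so it passes to the limit along a minimizing sequence. *)
Lemma energy_ge_partition : - ln Z - b / 2 * pairing f f <= energy b f.
Proof.
have [mf f0 _] := fp; have [fi _ _] := fd; have [gi _ _] := gd.
have fe : mu.-integrable setT (EFin \o (fun x => f x * ln (f x))) by case: fa.
have igf := integrable_ln_gibbs b0 mU UC fd.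
have iD1 : mu.-integrable setT
    (EFin \o (fun x => f x * ln (f x) - ln (g x) * f x)).
  exact: (integrableB measurableT fe igf).
have : \int[mu]_x (f x - g x) <= \int[mu]_x (f x * ln (f x) - ln (g x) * f x).
  apply: le_Rintegral => //; first exact: (integrableB measurableT fi gi).
  move=> x _; rewrite [ln (g x) * _]mulrC; apply: xlnx_tangent => //.
  exact: (gibbs_gt0 b0 mU UC).
rewrite (RintegralB measurableT fi gi) (RintegralB measurableT fe igf).
rewrite (Rintegral_density fd) (Rintegral_density gd) subrr.
rewrite (Rintegral_ln_gibbs b0 mU UC fd).
by rewrite -/Z -/(pairing f f) -/(entropy f) /energy; lra.
Qed.

End near_minimizer.

Lemma density_dist f h (phi : M -> R) : prob_density mu f -> prob_density mu h ->
  measurable_fun setT phi -> (forall x, `|phi x| <= C) ->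
  `|\int[mu]_x (phi x * f x) - \int[mu]_x (phi x * h x)| <=
  C * \int[mu]_x `|f x - h x|.
Proof.
move=> [fi _ _] [hi _ _] mphi phiC.
have iphif := integrable_bddM fi mphi phiC.
have iphih := integrable_bddM hi mphi phiC.
have ifh := integrable_norm (integrableB measurableT fi hi).
rewrite -RintegralB//.
apply: le_trans
  (le_normr_Rintegral measurableT (integrableB measurableT iphif iphih)) _.
rewrite -(RintegralZl C measurableT ifh); apply: le_Rintegral => //.
- exact: (integrable_norm (integrableB measurableT iphif iphih)).
- exact: (integrableZl measurableT C ifh).
- by move=> x _; rewrite /= -mulrBr normrM ler_wpM2r.
Qed.

Lemma energy_ge0 (b : R) f : 0 <= b -> admissible f -> 0 <= energy b f.
Proof.
move=> b0 [fp fe]; have fd := pos_normalized_density fp.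
have [_ f0 _] := fp; have [fi _ _] := fd.
have i1 := integrable_cst mu 1.
apply: addr_ge0; last first.
  by rewrite mulr_ge0 ?divr_ge0//; have /andP[] := pairing_itv fd fd.
have -> : 0 = \int[mu]_x (f x - 1) :> R.
  by rewrite (RintegralB measurableT fi i1) (Rintegral_density fd)
    (Rintegral_prob_cst mu) subrr.
apply: le_Rintegral => //; first exact: (integrableB measurableT fi i1).
by move=> x _; exact: xlnx_ge.
Qed.

Lemma lipschitz_gibbs (b : R) (V : M -> R) : 0 <= b -> measurable_fun setT V ->
  (forall x, 0 <= V x <= C) -> (forall x y, `|V x - V y| <= L * mdist x y) ->
  lipschitz_metric (gibbs b V).
Proof.
move=> b0 mV VC VL; have Z0 := partition_gt0 b0 mV VC.
exists ((partition b V)^-1 * (b * L)).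
  by rewrite mulr_ge0 ?invr_ge0 ?mulr_ge0// ltW.
move=> x y; rewrite /gibbs -mulrBr normrM gtr0_norm ?invr_gt0// -mulrA.
rewrite ler_pM2l ?invr_gt0// !mulNr.
have bV z : 0 <= b * V z by rewrite mulr_ge0//; have /andP[] := VC z.
apply: le_trans (expR_dist (bV x) (bV y)) _.
by rewrite -mulrBr normrM ger0_norm// -mulrA ler_wpM2l.
Qed.

(** * Existence of a minimizer *)

Theorem exists_minimizer (b : R) : 0 <= b ->
  exists g : M -> R, [/\ minimizes_free_energy mu u b g,
    onsager_solution mu u b g, (\int[mu]_x (g x)%:E = 1)%E,
    forall x, 0 < g x & lipschitz_metric g].
Proof.
move=> b0.
have C0 : 0 <= C.
  by have /andP[h1 h2] := uC (mdist_ge0 point (point : M)); exact: le_trans h2.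
pose S := [set energy b f | f in admissible].
have hS : has_inf S.
  split; last by exists 0 => _ [f fa <-]; exact: energy_ge0.
  exists (energy b (gibbs b (fun=> 0))); exists (gibbs b (fun=> 0)) => //.
  by apply: gibbs_admissible => // x; rewrite lexx.
pose K := inf S.
have K_le h : admissible h -> K <= energy b h.
  by move=> ha; apply: ge_inf; [case: hS|exists h].
(* The shift by two keeps [lam n] at most [1 / 2], as [dist_gibbs_le] requires. *)
pose lam (n : nat) : R := n.+2%:R^-1.
have lam0 n : 0 < lam n by rewrite invr_gt0.
have lam1 n : 0 < lam n <= 1 / 2.
  by rewrite lam0 div1r lef_pV2 ?posrE// ler_nat.
have lam_cvg : lam n @[n --> \oo] --> 0.
  by have := @cvg_harmonic R; rewrite -cvg_shiftS.
have /choice[f_ fP] n : exists f, admissible f /\ energy b f <= K + lam n ^+ 4.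
  have [_ [f fa <-] fK] := inf_adherent (exprn_gt0 4 (lam0 n)) hS.
  by exists f; split => //; exact: ltW.
have fa n : admissible (f_ n) by have [] := fP n.
have fd n : prob_density mu (f_ n) by apply: pos_normalized_density; case: (fa n).
have [s s_lt cs] := density_extraction fd.
have s_ge n : (n <= s n)%N.
  by elim: n => // n ih; apply: leq_ltn_trans ih (s_lt _ _ (ltnSn n)).
pose U_ n := potential mu u (f_ (s n)).
pose V (x : M) : R := limn (fun n => U_ n x).
have UV x : U_ n x @[n --> \oo] --> V x.
  by apply: (cs (fun y => u (mdist x y))); exact: continuous_kernel.
have mU n : measurable_fun setT (U_ n) by exact: measurable_potential.
have UC n x : 0 <= U_ n x <= C by exact: potential_itv.
have mV : measurable_fun setT V.
  by apply: (measurable_fun_cvg mU) => x _; exact: UV.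
have VC x : 0 <= V x <= C.
  apply/andP; split.
    apply: limr_ge; [exact: cvgP (UV x)|apply: nearW => n].
    by have /andP[] := UC n x.
  apply: limr_le; [exact: cvgP (UV x)|apply: nearW => n].
  by have /andP[] := UC n x.
pose g_ n := gibbs b (U_ n).
pose g := gibbs b V.
have gd_ n : prob_density mu (g_ n) by exact: gibbs_density.
have gd : prob_density mu g by exact: gibbs_density.
have ga : admissible g by exact: gibbs_admissible.
have w_cvg x : expR (- b * U_ n x) @[n --> \oo] --> expR (- b * V x).
  apply: continuous_cvg; first exact: continuous_expR.
  by apply: cvgM; [exact: cvg_cst|exact: UV].
have Z_cvg : partition b (U_ n) @[n --> \oo] --> partition b V.
  apply: (@dominated_Rintegral _ _ 1) => //.
  - by move=> n; apply: measurableT_comp => //; exact: measurable_funM.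
  - by apply: measurableT_comp => //; exact: measurable_funM.
  - move=> n x; rewrite ger0_norm ?expR_ge0//.
    by have /andP[] := gibbs_weight b0 (UC n) x.
have Z0 := partition_gt0 b0 mV VC.
have g_cvg x : g_ n x @[n --> \oo] --> g x.
  by apply: cvgM => //; apply: cvgV => //; rewrite gt_eqF.
have gb n x : `|g_ n x| <= expR (b * C) by exact: gibbs_bound.
pose dl n := \int[mu]_x `|f_ (s n) x - g_ n x|.
have dl_cvg : C * dl n @[n --> \oo] --> 0.
  apply: (@squeeze_cvgr _ _ _ _ (fun=> 0) (fun n => C * (lam n * (3 + b * C)))).
  - apply: nearW => n; apply/andP; split.
      by rewrite mulr_ge0//; apply: Rintegral_ge0.
    rewrite ler_wpM2l//.
    have := dist_gibbs_le b0 (fa (s n)) K_le (lam1 (s n)) (proj2 (fP (s n))).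
    move=> /le_trans; apply; rewrite ler_wpM2r//.
      by rewrite addr_ge0// mulr_ge0.
    by rewrite lef_pV2 ?posrE// ler_nat !ltnS.
  - exact: cvg_cst.
  - have -> : 0 = C * (0 * (3 + b * C)) by rewrite mul0r mulr0.
    apply: cvgM; first exact: cvg_cst.
    by apply: cvgM; [exact: lam_cvg|exact: cvg_cst].
(* L1 closeness of [f_ (s n)] and [g_ n] lets limits be computed with [g_ n],
   which converges pointwise and boundedly. *)
have transfer (phi_ : nat -> M -> R) (l : R) :
    (forall n, measurable_fun setT (phi_ n)) -> (forall n x, `|phi_ n x| <= C) ->
    \int[mu]_x (phi_ n x * g_ n x) @[n --> \oo] --> l ->
    \int[mu]_x (phi_ n x * f_ (s n) x) @[n --> \oo] --> l.
  move=> mphi phiC gl.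
  rewrite -(addr0 l).
  rewrite (_ : (fun n => _) = (fun n => \int[mu]_x (phi_ n x * g_ n x) +
      (\int[mu]_x (phi_ n x * f_ (s n) x) - \int[mu]_x (phi_ n x * g_ n x)))).
    apply: cvgD => //; apply/norm_cvg0P.
    apply: (@squeeze_cvgr _ _ _ _ (fun=> 0) (fun n => C * dl n)) => //.
      by apply: nearW => n; rewrite normr_ge0/=; exact: density_dist.
    exact: cvg_cst.
  by apply/funext => n; rewrite addrC subrK.
(* By [transfer], the limit of the potentials of [f_ (s n)] is also that of the potentials of
   [g_ n], which dominated convergence computes. *)
have VE : V = potential mu u g.
  apply/funext => x; apply: (cvg_lim (@Rhausdorff R)).
  apply: (transfer (fun _ y => u (mdist x y))) => [n|n y|].
  - exact: measurable_kernel.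
  - exact: kernel_bound.
  apply: (@dominated_Rintegral _ _ (C * expR (b * C))).
  - by move=> n; apply: measurable_funM; [exact: measurable_kernel|exact: measurable_gibbs].
  - by apply: measurable_funM; [exact: measurable_kernel|exact: measurable_gibbs].
  - by move=> n y; rewrite normrM ler_pM// kernel_bound.
  - by move=> y; apply: cvgM; [exact: cvg_cst|exact: g_cvg].
have Un n x : `|U_ n x| <= C by exact: potential_bound.
have pair_cvg : pairing (f_ (s n)) (f_ (s n)) @[n --> \oo] --> pairing g g.
  apply: (transfer U_) => //; rewrite /pairing -VE.
  apply: (@dominated_Rintegral _ _ (C * expR (b * C))).
  - by move=> n; apply: measurable_funM => //; exact: measurable_gibbs.
  - by apply: measurable_funM => //; exact: measurable_gibbs.
  - by move=> n y; rewrite normrM ler_pM.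
  - by move=> y; apply: cvgM; [exact: UV|exact: g_cvg].
(* As [V] is the potential of [g], the energy of [g] is the limit of the lower bounds of
   [energy_ge_partition], and these are at most [K + lam n ^+ 4]. *)
have EK : energy b g <= K.
  have -> : energy b g = - ln (partition b V) - b / 2 * pairing g g.
    rewrite /energy (_ : entropy g = - ln (partition b V) - b * pairing g g).
      by move: (ln _) (pairing _ _) => l p; lra.
    have -> : pairing g g = \int[mu]_x (V x * g x) by rewrite /pairing -VE.
    rewrite -(Rintegral_ln_gibbs b0 mV VC gd).
    by apply: eq_Rintegral => x _; rewrite mulrC.
  have cl : - ln (partition b (U_ n)) - b / 2 * pairing (f_ (s n)) (f_ (s n))
      @[n --> \oo] --> - ln (partition b V) - b / 2 * pairing g g.
    apply: cvgB; last by apply: cvgM; [exact: cvg_cst|exact: pair_cvg].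
    by apply: cvgN; apply: continuous_cvg => //; exact: continuous_ln.
  have cr : K + lam n ^+ 4 @[n --> \oo] --> K.
    rewrite -[X in _ --> X]addr0; apply: cvgD; first exact: cvg_cst.
    rewrite [X in _ --> X](_ : _ = 0 ^+ 4); last by rewrite expr0n.
    exact: (cvg_comp _ _ lam_cvg (@exprn_continuous R 4 0)).
  apply: (ler_cvg_to cl cr); apply: nearW => n.
  apply: le_trans (energy_ge_partition b0 (fa (s n))) _.
  apply: le_trans (proj2 (fP (s n))) _; rewrite lerD2l.
  by rewrite lerXn2r ?nnegrE ?(ltW (lam0 _))// lef_pV2 ?posrE// ler_nat !ltnS.
exists g; have [gp _] := ga; split.
- split => // f fp; have [fad|nfa] := pselect (admissible f).
    by rewrite !free_energyE// lee_fin (le_trans EK)// K_le.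
  by rewrite (free_energy_not_admissible b0 fp nfa) leey.
- by split => // x; rewrite /partition_fun -VE.
- by have [] := gp.
- by have [] := gp.
- by apply: lipschitz_gibbs => // x y; rewrite VE; exact: potential_lip.
Qed.

End potential.

(** * Uniform convergence, and integrals against a measure with a density *)

(** A finite net of radius [e / 3 / L] reduces the claim to convergence at finitely many points,
    with three errors of [e / 3]. *)
Lemma equi_lipschitz_cvg (F_ : nat -> M -> R) (F : M -> R) (L : R) : 0 < L ->
  (forall n x y, `|F_ n x - F_ n y| <= L * mdist x y) ->
  (forall x y, `|F x - F y| <= L * mdist x y) ->
  (forall x, F_ n x @[n --> \oo] --> F x) ->
  forall e : R, 0 < e -> \forall n \near \oo, forall x, `|F_ n x - F x| <= e.
Proof.
move=> L0 F_L FL cF e e0.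
have e3 : 0 < e / 3 by rewrite divr_gt0.
have [s sM] : exists s : seq M,
    forall y, exists2 x, x \in s & mdist x y < e / 3 / L.
  by apply: finite_net; rewrite divr_gt0.
have : \forall n \near \oo, forall x, x \in s -> `|F_ n x - F x| < e / 3.
  elim: s {sM} => [|x s ih]; first by apply: nearW => n x; rewrite in_nil.
  have /cvgrPdist_lt/(_ _ e3) := cF x; move: ih; apply: filterS2 => n sn xn y.
  by rewrite in_cons => /predU1P[->|]; [rewrite distrC|exact: sn].
apply: filterS => n sn y; have [x xs xy] := sM y.
have := sn x xs; have := F_L n x y; have := FL x y.
move: xy; rewrite ltr_pdivlMr// mulrC; move: (L * _) => D.
rewrite !ler_norml ltr_norml; lra.
Qed.

(** [has_density] only equates masses of sets. Over a fine partition both integrals are within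
    [e / 2] of the same sum of cell masses; for [nu] this uses the density [1] of [nu] with respect
    to itself. *)
Lemma has_density_integral (mu nu : probability M R) (g phi : M -> R) :
  prob_density mu g -> has_density mu nu g -> continuous phi ->
  \int[nu]_x phi x = \int[mu]_x (phi x * g x).
Proof.
move=> gd nug cphi.
have mphi := continuous_measurable cphi; have [c phic] := compact_bounded cphi.
have od : prob_density nu (fun=> 1).
  split => [|x|]; first exact: integrable_cst; first exact: ler01.
  rewrite -(fineK (integrable_fin_num _ (integrable_cst nu 1)))//.
  by rewrite -[fine _]/(\int[nu]_x 1) Rintegral_prob_cst.
have -> : \int[nu]_x phi x = \int[nu]_x (phi x * 1).
  by apply: eq_Rintegral => x _; rewrite mulr1.
apply/eqP; rewrite -subr_eq0 -normr_le0; apply/ler_addgt0Pl => e e0.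
rewrite addr0; have e2 : 0 < e / 2 by rewrite divr_gt0.
have [r r0 phir] := compact_uniformly_continuous cphi e2.
have [N [x [j [jN xj mj]]]] := quantizer r0.
have w y : `|phi y - phi (x (j y))| <= e / 2.
  by apply/ltW/phir; rewrite metric_sym.
have := quantized_integral gd mphi phic jN mj w.
have := quantized_integral od mphi phic jN mj w.
have -> : \sum_(i < N) phi (x i) * \int[nu]_y (\1_[set y | j y = i] y * 1) =
    \sum_(i < N) phi (x i) * \int[mu]_y (\1_[set y | j y = i] y * g y).
  apply: eq_bigr => i _; congr (_ * _).
  under eq_Rintegral do rewrite mulr1.
  rewrite /Rintegral integral_indic// setIT; congr fine.
  apply: etrans (nug _ (mj i)) _; rewrite [LHS]integral_mkcond.
  apply: eq_integral => y _; rewrite /patch indicE.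
  by case: ifP => _ /=; rewrite ?mul1r ?mul0r.
by rewrite !ler_norml; lra.
Qed.

(** * Concentration as b tends to infinity *)

Section concentration.
Variables (mu : probability M R) (u : R -> R) (C L : R).
Hypotheses (L0 : 0 < L) (uC : forall t, 0 <= t -> 0 <= u t <= C).
Hypothesis uL : forall t1 t2, 0 <= t1 -> 0 <= t2 ->
  `|u t1 - u t2| <= L * `|t1 - t2|.
Hypothesis mu_ball : forall (x : M) (r : R), 0 < r -> (0 < mu (ball x r))%E.

(* [x ln x >= x - 1] makes the entropy of [g] nonnegative, that is
   [b \int U g <= - ln Z]; restricting [Z] to [B] bounds it below. *)
Lemma onsager_mean_potential (b a : R) (g : M -> R) (B : set M) : 0 < b ->
  onsager_solution mu u b g -> measurable B -> (0 < mu B)%E ->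
  (forall x, B x -> potential mu u g x <= a) ->
  \int[mu]_x (potential mu u g x * g x) <= a - ln (fine (mu B)) / b.
Proof.
move=> b0 [gd gE] mB B0 Ba.
have b0' := ltW b0.
pose U := potential mu u g.
have mU : measurable_fun setT U := measurable_potential L0 uC uL gd.
have UC : forall x, 0 <= U x <= C := fun x => potential_itv L0 uC uL x gd.
have gE' : g = gibbs mu b U by apply/funext => x; exact: gE.
have gi : mu.-integrable setT (EFin \o g) by case: gd.
have g0 x : 0 < g x by rewrite gE'; exact: (gibbs_gt0 mu b0' mU UC).
have i1 := integrable_cst mu 1.
have : \int[mu]_x (g x - 1) <= \int[mu]_x (ln (gibbs mu b U x) * g x).
  apply: le_Rintegral => //; first exact: (integrableB measurableT gi i1).
    exact: (integrable_ln_gibbs b0' mU UC gd).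
  by move=> x _; rewrite -gE' mulrC; exact: xlnx_ge.
rewrite (RintegralB measurableT gi i1) (Rintegral_density gd).
rewrite (Rintegral_prob_cst mu) subrr (Rintegral_ln_gibbs b0' mU UC gd) => H.
have fB : 0 < fine (mu B).
  by rewrite fine_gt0// B0 -ge0_fin_numE// fin_num_measure.
have Z0 := partition_gt0 mu b0' mU UC.
have ZB : expR (- b * a) * fine (mu B) <= partition mu b U.
  have -> : expR (- b * a) * fine (mu B) = \int[mu]_x (expR (- b * a) * \1_B x).
    rewrite RintegralZl//; last exact: integrable_indic.
    by rewrite /Rintegral integral_indic// setIT.
  apply: le_Rintegral => //.
  - exact: (integrableZl measurableT (expR (- b * a)) (integrable_indic mu mB)).
  - apply: (@integrable_bdd mu _ 1).
      by apply: measurableT_comp => //; exact: measurable_funM.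
    move=> x; rewrite ger0_norm ?expR_ge0//.
    by have /andP[] := gibbs_weight b0' UC x.
  - move=> x _; rewrite indicE; case: (boolP (x \in B)) => [|_].
      by rewrite inE mulr1 ler_expR !mulNr lerN2 ler_pM2l// => /Ba.
    by rewrite mulr0 expR_ge0.
have : ln (expR (- b * a) * fine (mu B)) <= ln (partition mu b U).
  by rewrite ler_ln ?posrE// mulr_gt0 ?expR_gt0.
rewrite lnM ?posrE ?expR_gt0// expRK mulNr => lnZ.
rewrite -(ler_pM2l b0) mulrBr mulrCA divff ?gt_eqF// mulr1.
by rewrite -/U; lra.
Qed.

Theorem solutions_concentrate (b_ : nat -> R) (g_ : nat -> M -> R)
    (nu_ : nat -> probability M R) :
  b_ n @[n --> \oo] --> +oo ->
  (forall n, onsager_solution mu u (b_ n) (g_ n)) ->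
  (forall n, has_density mu (nu_ n) (g_ n)) ->
  exists (s : nat -> nat) (nu : probability M R),
    [/\ {homo s : m n / (m < n)%N}, weak_cvg (nu_ \o s) nu &
      exists Uoo : M -> R,
        [/\ forall x, 0 <= Uoo x, lipschitz_metric Uoo,
          nu (~` argmin Uoo) = 0%E, open (~` argmin Uoo) &
          forall phi : M -> R, continuous phi ->
            closure [set x | phi x != 0] `<=` ~` argmin Uoo ->
            \int[mu]_x (phi x * g_ (s n) x) @[n --> \oo] --> (0 : R)]].
Proof.
move=> b_oo gs nug.
have gd n : prob_density mu (g_ n) by have [] := gs n.
have [s s_lt [nu nuP]] := density_weak_compactness gd.
have s_ge n : (n <= s n)%N.
  by elim: n => // n ih; apply: leq_ltn_trans ih (s_lt _ _ (ltnSn n)).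
exists s, nu; split => //.
  move=> phi cphi; have := nuP phi cphi; apply: cvg_trans; apply: near_eq_cvg.
  by apply: nearW => n; rewrite /= (has_density_integral (gd (s n)) (nug (s n))).
(* The potential of [nu], which will be [Uoo]; the [U_ n] converge to it pointwise since the kernel
   is continuous. *)
pose U x := \int[nu]_y u (mdist x y).
pose U_ n := potential mu u (g_ (s n)).
have U_U x : U_ n x @[n --> \oo] --> U x.
  by apply: (nuP (fun y => u (mdist x y))); exact: (continuous_kernel L0 uL).
have U_L n x y : `|U_ n x - U_ n y| <= L * mdist x y.
  exact: (potential_lip L0 uC uL x y (gd (s n))).
have UL x y : `|U x - U y| <= L * mdist x y.
  have c : `|U_ n x - U_ n y| @[n --> \oo] --> `|U x - U y|.
    by apply: cvg_norm; apply: cvgB.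
  by rewrite -(cvg_lim (@Rhausdorff R) c); apply: limr_le;
    [exact: cvgP c|exact: nearW].
have lU : lipschitz_metric U by exists L; [exact: ltW|].
have cU := lipschitz_metric_continuous lU.
have U0 x : 0 <= U x.
  by apply: Rintegral_ge0 => y _; have /andP[] := uC (mdist_ge0 x y).
have [xm Um] : exists xm, forall y, U xm <= U y.
  have [| |xm _ xmP] := @compact_EVT_min M R U setT _ hc.
  - by exists point.
  - exact: continuous_subspaceT.
  - by exists xm => y; rewrite xmP ?inE.
have argminE x : argmin U x <-> U x <= U xm.
  by split => [/(_ xm)|h y]; [|exact: le_trans h (Um y)].
have ocU : open (~` argmin U).
  rewrite (_ : ~` _ = U @^-1` [set r | U xm < r]); last first.
    by apply/seteqP; split => x /=; rewrite argminE ltNge => /negP.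
  by apply: open_comp => [x _|]; [exact: cU|exact: open_gt].
have mcU : measurable (~` argmin U) by rewrite hb; exact: sub_sigma_algebra.
have [c Uc] := compact_bounded cU.
have mU := continuous_measurable cU.
have iU := integrable_bdd nu mU Uc.
have iUm := integrable_cst nu (U xm).
have le_min : \int[nu]_x U x <= U xm.
  apply/ler_addgt0Pr => e e0.
  (* Four errors of [d0] occur: the variation of [U] on [B], the distance from [U_ n] to [U] on [B]
     and again under the integral, and the logarithmic term. *)
  pose d0 := e / 5.
  have d00 : 0 < d0 by rewrite divr_gt0.
  pose B := ball xm (d0 / L).
  have B0 : (0 < mu B)%E by apply: mu_ball; rewrite divr_gt0.
  have mB : measurable B by exact: measurable_mball.
  have BU x : B x -> U x <= U xm + d0.
    rewrite /B ballEmdist/= ltr_pdivlMr// mulrC => xB.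
    by have := UL xm x; rewrite ler_norml; lra.
  apply: (ler_cvg_to (nuP U cU) (cvg_cst (U xm + e))).
  have unif := equi_lipschitz_cvg L0 U_L UL U_U d00.
  (* Past this threshold the logarithmic term is at most [d0]; the [+ 1] makes [b_] positive. *)
  have [n0 _ n0P] := (cvgryPge _).1 b_oo (`|ln (fine (mu B))| / d0 + 1).
  have : \forall n \near \oo, `|ln (fine (mu B))| / d0 + 1 <= b_ (s n).
    by exists n0 => // n /= n0n; apply: n0P; exact: leq_trans n0n (s_ge n).
  move: unif; apply: filterS2 => n Un bn.
  have bn0 : 0 < b_ (s n).
    by apply: lt_le_trans bn; rewrite ltr_wpDl// divr_ge0// ltW.
  have H : \int[mu]_x (U_ n x * g_ (s n) x) <=
      U xm + 2 * d0 - ln (fine (mu B)) / b_ (s n).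
    apply: onsager_mean_potential => // x /BU xB.
    by have := Un x; rewrite -/(U_ n x) ler_norml; lra.
  have lnb : - (ln (fine (mu B)) / b_ (s n)) <= d0.
    rewrite -mulNr ler_pdivrMr//.
    have : d0 * (`|ln (fine (mu B))| / d0 + 1) <= d0 * b_ (s n).
      by rewrite ler_pM2l.
    rewrite mulrDr mulrCA divff ?gt_eqF// !mulr1.
    by have := lexx `|ln (fine (mu B))|; rewrite {1}ler_norml; lra.
  have mU_ : measurable_fun setT (U_ n).
    exact: (measurable_potential L0 uC uL (gd (s n))).
  have gi : mu.-integrable setT (EFin \o g_ (s n)) by case: (gd (s n)).
  have : `|\int[mu]_x (U_ n x * g_ (s n) x) -
           \int[mu]_x (U x * g_ (s n) x)| <= d0.
    rewrite -RintegralB//.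
    - under eq_Rintegral do rewrite -mulrBl.
      by apply: density_bound => //; exact: measurable_funB.
    - apply: (integrable_bddM gi mU_) => x.
      exact: (potential_bound L0 uC uL x (gd (s n))).
    - exact: (integrable_bddM gi mU Uc).
  by rewrite ler_norml /d0 in lnb H *; lra.
(* [U - U xm] is nonnegative with integral at most zero, so it vanishes [nu]-almost everywhere. *)
have nu0 : nu (~` argmin U) = 0%E.
  have iD := integrableB measurableT iU iUm.
  have I0 : (\int[nu]_x `|(U x - U xm)%:E| = 0)%E.
    under eq_integral do rewrite abse_EFin ger0_norm ?subr_ge0//.
    rewrite -(fineK (integrable_fin_num _ iD))//.
    rewrite -[fine _]/(\int[nu]_x (U x - U xm)) (RintegralB measurableT iU iUm).
    rewrite (Rintegral_prob_cst nu); congr EFin; apply/eqP.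
    rewrite eq_le subr_le0 le_min subr_ge0 -[leLHS](Rintegral_prob_cst nu).
    by apply: le_Rintegral.
  have mD : measurable_fun setT (fun x => (U x - U xm)%:E).
    by apply/measurable_EFinP; exact: measurable_funB.
  have [N [mN N0 sN]] := (ae_eq_integral_abs nu measurableT mD).1 I0.
  apply: (subset_measure0 mcU mN) => // x nx; apply: sN => /= /(_ I) [h].
  by apply: nx; apply/argminE; rewrite -subr_le0 h.
exists U; split => //.
move=> phi cphi sphi.
(* [phi] vanishes on the argmin set, which has full [nu]-measure, so weak convergence gives the
   limit zero. *)
have -> : 0 = \int[nu]_x phi x :> R; last exact: nuP.
rewrite /Rintegral (ae_eq_integral (cst 0%E)) ?integral0//.
- by apply/measurable_EFinP; exact: continuous_measurable.
- exists (~` argmin U); split => // x /= h; apply: sphi; apply: subset_closure.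
  by apply/eqP => phix; apply: h => _; rewrite phix.
Qed.
End concentration.
End metric_measure.

(** * Existence and concentration under the lower bound on balls *)

Theorem theorem1 (R : realType) (d : measure_display)
    (M : measurableMetricType d R) (mu : probability M R) (u : R -> R)
    (hborel : is_borel M)
    (hcompact : compact [set: M])
    (hmu : exists k c : R, [/\ 0 < k, k < 1, 0 < c &
       exists2 r0 : R, 0 < r0 & forall (x : M) (r : R), 0 < r -> r <= r0 ->
         ((c * expR (- (r `^ (- k))))%:E <= mu (ball x r))%E])
    (hu : exists C L : R, [/\ 0 < C, 0 < L,
       forall t, 0 <= t -> 0 <= u t <= C &
       forall t1 t2, 0 <= t1 -> 0 <= t2 ->
         `|u t1 - u t2| <= L * `|t1 - t2|]) :
  (forall b : R, 0 < b ->
     exists g : M -> R,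
       [/\ minimizes_free_energy mu u b g,
           onsager_solution mu u b g,
           (\int[mu]_x (g x)%:E = 1)%E,
           forall x, 0 < g x &
           lipschitz_metric g])
  /\
  (forall (b_ : nat -> R) (g_ : nat -> M -> R) (nu_ : nat -> probability M R),
     (forall n, 0 <= b_ n) ->
     b_ n @[n --> \oo] --> +oo ->
     (forall n, onsager_solution mu u (b_ n) (g_ n)) ->
     (forall n, has_density mu (nu_ n) (g_ n)) ->
     exists (s : nat -> nat) (nu : probability M R),
       [/\ {homo s : m n / (m < n)%N},
           weak_cvg (nu_ \o s) nu &
           exists Uoo : M -> R,
             [/\ forall x, 0 <= Uoo x,
                 lipschitz_metric Uoo,
                 nu (~` argmin Uoo) = 0%E,
                 open (~` argmin Uoo) &
                 forall phi : M -> R, continuous phi ->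
                   closure [set x | phi x != 0] `<=` ~` argmin Uoo ->
                   \int[mu]_x (phi x * g_ (s n) x) @[n --> \oo] --> (0 : R)]]).
Proof.
have [k [c [_ _ c0 [r0 r00 muB]]]] := hmu.
have [C [L [_ L0 uC uL]]] := hu.
(* Balls of radius at most [r0] have positive measure by the lower bound; larger balls contain one
   of these. *)
have mu_ball (x : M) (r : R) : 0 < r -> (0 < mu (ball x r))%E.
  move=> rp; pose r' := Num.min r r0.
  have r'0 : 0 < r' by rewrite lt_min rp.
  have := muB x r' r'0; rewrite ge_min lexx orbT => /(_ isT) h.
  apply: (@lt_le_trans _ _ (mu (ball x r'))).
    by apply: lt_le_trans h; rewrite lte_fin mulr_gt0// expR_gt0.
  apply: le_measure; rewrite ?inE; [exact: measurable_mball..|].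
  by apply: le_ball; rewrite ge_min lexx.
split => [b b0|b_ g_ nu_ _ b_oo gs nug].
  exact: (exists_minimizer hborel hcompact mu L0 uC uL (ltW b0)).
exact: (solutions_concentrate hborel hcompact L0 uC uL mu_ball b_oo gs nug).
Qed.
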